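(* Let $\Gamma=\Gamma(D,N)$ be the group of reduced-norm-one units of an Eichler order of level $N$ in an indefinite quaternion $\mathbb{Q}$-algebra of discriminant $D>1$, and let $p$ be a prime with $p\mid N$ and $p\nmid D$. Let $f\in S_2(\Gamma)$ be an eigenform for $T_p$ with eigenvalue $a_p\neq 0$, let $\tau\in\mathcal{H}$ be a quadratic imaginary point, and let $\sigma$ be a bijection of $\{0,\dots,p-1\}$ with $\sigma(0)=0$. For $n\ge1$ and $a=\sum_{i=0}^{n-1}a_ip^i$ with $0\le a_i\le p-1$ and $a_0\ne 0$, put $$\mu_{\mathcal{Q}}^{\sigma}(a+p^n\mathbb{Z}_p)=a_p^{-n}\Big(\phi_f^{\tau}\big(\gamma_{\sigma(a_{n-1})}\cdots\gamma_{\sigma(a_0)}(\tau)\big)-\phi_f^{\tau}\big(\gamma_{\sigma(p-a_{n-1})}\cdots\gamma_{\sigma(p-a_0)}(\tau)\big)\Big),$$ $$\mu^{\sigma}_{\mathcal{Q}}(\mathbb{Z}_p^* )=\sum_{a=1}^{p-1}\mu^{\sigma}_{\mathcal{Q}}(a+p\mathbb{Z}_p),\qquad \mu^{\sigma}_{\mathcal{Q}}(p\mathbb{Z}_p)=0.$$ Then $\mu_{\mathcal{Q}}^{\sigma}$ extends, in a unique way, to a $c_{00}(\mathbb{C}_p)$-valued $p$-adic distribution (on $\mathbb{Z}_p^*$, extended by zero to $p\mathbb{Z}_p$).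
   Context: Groups. $H=\left(\frac{a,b}{\mathbb{Q}}\right)$ is generated over $\mathbb{Q}$ by $I,J$ with $I^2=a$, $J^2=b$, $IJ=-JI$, $K=IJ$; it is indefinite ($H\otimes\mathbb{R}\simeq \mathrm{M}(2,\mathbb{R})$), presented with $a>0$, and $\phi:H\to \mathrm{M}(2,\mathbb{Q}(\sqrt a))\subset \mathrm{M}(2,\mathbb{R})$ is $\phi(x+yI+zJ+tK)=\begin{pmatrix}x+y\sqrt a& z+t\sqrt a\\ b(z-t\sqrt a)& x-y\sqrt a\end{pmatrix}$. For an Eichler order $\mathcal{O}$ (intersection of two maximal orders) of level $N$, $\Gamma=\phi(\{\omega\in\mathcal{O}:\mathrm{N}(\omega)=1\})$, acting on the upper half-plane $\mathcal{H}$ by Möbius transformations; since $D>1$ it is cocompact. Forms. For $\gamma=\begin{pmatrix}a&b\\c&d\end{pmatrix}$ with $\det\gamma>0$, $(f|_2\gamma)(z)=\det(\gamma)(cz+d)^{-2}f(\gamma z)$. $S_2(\Gamma)$ is the space of holomorphic $f:\mathcal{H}\to\mathbb{C}$ with $f|_2\gamma=f$ for all $\gamma\in\Gamma$. Hecke operator. $T_p$ is the operator attached to $\Gamma\eta_p\Gamma$, where $\eta_p=\phi(\omega_p)$ with $\omega_p$ a quaternion of reduced norm $p$; for $p\mid N$, $p\nmid D$ the orbit space $\Gamma\backslash\Gamma\eta_p\Gamma$ has $p$ elements. Fix representatives $\gamma_1,\dots,\gamma_p$ (so $\Gamma\eta_p\Gamma=\bigsqcup_{j}\Gamma\gamma_j$),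 with indices read modulo $p$ so that $\gamma_0=\gamma_p$; then $T_p(f)=\sum_{j=1}^p f|_2\gamma_j$. In expressions $\sigma(p-a_i)$ the argument is also read modulo $p$, so that $\sigma(p)=\sigma(0)=0$. Integrals. A quadratic imaginary point is a $\tau\in\mathcal{H}$ of degree $2$ over $\mathbb{Q}$. For $z\in\mathcal{H}$, $\phi_f^{\tau}(z)=\int_z^{\tau}f(w)\,dw$. Values. The eigenvalue $a_p$ is an algebraic integer; fix an embedding of $\mathbb{Q}(a_p)$ into $\mathbb{C}_p$. Let $W\subset\mathbb{C}$ be the $\mathbb{Q}(a_p)$-span of the numbers $\phi_f^\tau(\gamma_{i_1}\cdots\gamma_{i_n}(\tau))$, of at most countable dimension. Choosing a basis identifies $W\otimes_{\mathbb{Q}(a_p)}\mathbb{C}_p$ with a subspace of $c_{00}(\mathbb{C}_p)$, the space of sequences in $\mathbb{C}_p$ with only finitely many nonzero terms; the values of $\mu^\sigma_{\mathcal{Q}}$ are viewed there. A $p$-adic distribution with values in a $\mathbb{C}_p$-vector space is a finitely additive function on compact open sets. *)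

(* Defs.v *)
From HB Require Import structures.
From mathcomp Require Import all_boot all_order perm all_algebra.
From mathcomp Require Import all_classical all_reals all_analysis.
From mathcomp Require Import complex ring.

Set Implicit Arguments.
Unset Strict Implicit.
Unset Printing Implicit Defensive.

Import Order.TTheory GRing.Theory Num.Theory.
Import numFieldNormedType.Exports.

Local Open Scope classical_set_scope.
Local Open Scope ring_scope.

(* Z_p as the inverse limit of the Z/p^n: the n-th component is the canonical
   representative in [0, p^n[ of the class modulo p^n. *)
Definition coherent (p : nat) (u : nat -> int) : bool :=
  `[< forall n, u n = (u n.+1 %% (p ^ n)%N)%Z >].

Record padic_int (p : nat) (hp : prime p) :=
  PadicInt { residue :> nat -> int ; _ : coherent p residue }.

Section PadicInt.
Variables (p : nat) (hp : prime p).
Local Notation Zp := (padic_int hp).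
Implicit Types (x y z : Zp) (u : nat -> int) (n : nat).

HB.instance Definition _ := [isSub for @residue p hp].
HB.instance Definition _ := [Choice of Zp by <:].

Local Notation modulus n := (Posz (p ^ n)%N).

Lemma modz_modulus (c : int) n m : (n <= m)%N ->
  ((c %% modulus m)%Z = c %[mod modulus n])%Z.
Proof.
move=> nm; apply/eqP; rewrite eqz_mod_dvd {2}(divz_eq c (modulus m)).
by rewrite opprD addrCA subrr addr0 rpredN dvdz_mull // dvdzE /= dvdn_exp2l.
Qed.

Lemma residueS x n : x n = (x n.+1 %% modulus n)%Z.
Proof. by case: x => u /= /asboolP; exact. Qed.

Lemma padic_intP x y : (forall n, x n = y n) -> x = y.
Proof. by move=> xy; apply: val_inj; apply: funext. Qed.

Lemma residue_mod x n : (x n %% modulus n)%Z = x n.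
Proof. by rewrite residueS modz_mod. Qed.

Lemma mod_residueS x n : (x n.+1 = x n %[mod modulus n])%Z.
Proof. by rewrite residue_mod -residueS. Qed.

Lemma reduce_subproof u (cu : forall n, (u n.+1 = u n %[mod modulus n])%Z) :
  coherent p (fun n => (u n %% modulus n)%Z).
Proof.
apply/asboolP => n; rewrite -(cu n).
by rewrite modz_modulus //.
Qed.

Definition reduce u cu : Zp := PadicInt hp (@reduce_subproof u cu).

Definition const_int (c : int) : Zp := @reduce (fun=> c) (fun=> erefl).

Lemma add_subproof x y n :
  (x n.+1 + y n.+1 = x n + y n %[mod modulus n])%Z.
Proof. by rewrite -modzDm !mod_residueS modzDm. Qed.
Lemma opp_subproof x n : (- x n.+1 = - x n %[mod modulus n])%Z.
Proof. by rewrite -modzNm mod_residueS modzNm. Qed.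
Lemma mul_subproof x y n :
  (x n.+1 * y n.+1 = x n * y n %[mod modulus n])%Z.
Proof. by rewrite -modzMm !mod_residueS modzMm. Qed.

Definition padic_add x y := reduce (add_subproof x y).
Definition padic_opp x := reduce (opp_subproof x).
Definition padic_mul x y := reduce (mul_subproof x y).

Lemma padic_addA : associative padic_add.
Proof. by move=> x y z; apply: padic_intP => n /=; rewrite modzDml modzDmr addrA. Qed.
Lemma padic_addC : commutative padic_add.
Proof. by move=> x y; apply: padic_intP => n /=; rewrite addrC. Qed.
Lemma padic_add0 : left_id (const_int 0) padic_add.
Proof. by move=> x; apply: padic_intP => n /=; rewrite modzDml add0r residue_mod. Qed.
Lemma padic_addN : left_inverse (const_int 0) padic_opp padic_add.
Proof. by move=> x; apply: padic_intP => n /=; rewrite modzDml addNr. Qed.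

HB.instance Definition _ := GRing.isZmodule.Build Zp
  padic_addA padic_addC padic_add0 padic_addN.

Lemma padic_mulA : associative padic_mul.
Proof. by move=> x y z; apply: padic_intP => n /=; rewrite modzMml modzMmr mulrA. Qed.
Lemma padic_mulC : commutative padic_mul.
Proof. by move=> x y; apply: padic_intP => n /=; rewrite mulrC. Qed.
Lemma padic_mul1 : left_id (const_int 1) padic_mul.
Proof. by move=> x; apply: padic_intP => n /=; rewrite modzMml mul1r residue_mod. Qed.
Lemma padic_mulDl : left_distributive padic_mul padic_add.
Proof. by move=> x y z; apply: padic_intP => n /=; rewrite modzMml modzDm mulrDl. Qed.
Lemma padic_1_neq0 : const_int 1 != 0.
Proof.
apply/eqP => /(congr1 (fun x : Zp => x 1%N)) /=; rewrite expn1.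
by rewrite mod0z modz_small ?ltz_nat ?prime_gt1.
Qed.

HB.instance Definition _ := GRing.Zmodule_isComNzRing.Build Zp
  padic_mulA padic_mulC padic_mul1 padic_mulDl padic_1_neq0.

Definition padic_unit : pred Zp := fun x => `[< exists y, y * x = 1 >].
Definition padic_inv x : Zp := xget x [set y | y * x = 1].

Lemma padic_mulV : {in padic_unit, left_inverse 1 padic_inv *%R}.
Proof.
move=> x /asboolP[y yx]; rewrite /padic_inv.
by case: xgetP => [z _ //|/(_ y)].
Qed.
Lemma padic_unitP x y : y * x = 1 -> padic_unit x.
Proof. by move=> yx; apply/asboolP; exists y. Qed.
Lemma padic_inv_out : {in [predC padic_unit], padic_inv =1 id}.
Proof.
move=> x; rewrite inE => /asboolPn nx; rewrite /padic_inv.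
by case: xgetP => [z _ zx|//]; case: nx; exists z.
Qed.

HB.instance Definition _ := GRing.ComNzRing_hasMulInverse.Build Zp
  padic_mulV padic_unitP padic_inv_out.

Lemma residue_le x n m : (n <= m)%N -> (x m %% modulus n)%Z = x n.
Proof.
elim: m => [|m IH]; first by rewrite leqn0 => /eqP ->; rewrite residue_mod.
rewrite leq_eqVlt => /predU1P[->|]; first by rewrite residue_mod.
rewrite ltnS => nm; rewrite -(IH nm) (residueS x m) modz_modulus //.
Qed.

Lemma padic_domain x y : x * y = 0 -> (x == 0) || (y == 0).
Proof.
have nz z : z != 0 -> exists n, ~~ (modulus n %| z n)%Z.
  move=> z0; apply/not_existsP => zn; move/eqP: z0; apply; apply: padic_intP => n.
  have /negP := zn n; rewrite negbK => /dvdz_mod0P /=.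
  by rewrite residue_mod mod0z.
move=> xy0; apply: contraT; rewrite negb_or => /andP[/nz[n xn] /nz[m ym]].
have := congr1 (fun z : Zp => z (n + m)%N) xy0; rewrite /= mod0z.
move/dvdz_mod0P; rewrite dvdzE abszM /=.
have hx : ~~ (p ^ n %| `|x (n + m)%N|)%N.
  apply: contra xn => h; apply/dvdz_mod0P; rewrite residue_mod.
  rewrite -(@residue_le x n (n + m)) ?leq_addr //.
  by apply/dvdz_mod0P; rewrite dvdzE.
have hy : ~~ (p ^ m %| `|y (n + m)%N|)%N.
  apply: contra ym => h; apply/dvdz_mod0P; rewrite residue_mod.
  rewrite -(@residue_le y m (n + m)) ?leq_addl //.
  by apply/dvdz_mod0P; rewrite dvdzE.
have x0 : (0 < `|x (n + m)%N|)%N by rewrite lt0n; apply: contraNneq hx => ->.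
have y0 : (0 < `|y (n + m)%N|)%N by rewrite lt0n; apply: contraNneq hy => ->.
move: hx hy; rewrite !pfactor_dvdn ?muln_gt0 ?x0 // lognM // -!ltnNge => a b.
by rewrite leqNgt -addnS leq_add // ltnW.
Qed.

HB.instance Definition _ := GRing.ComUnitRing_isIntegral.Build Zp padic_domain.

Definition padic_coset x n : set Zp := [set x + p%:R ^+ n * y | y in setT].

Definition padic_open (A : set Zp) : Prop :=
  forall x, A x -> exists n, padic_coset x n `<=` A.

Lemma padic_openT : padic_open setT.
Proof. by move=> x _; exists 0%N. Qed.
Lemma padic_openI : setI_closed padic_open.
Proof.
move=> A B oA oB x [/oA[n An] /oB[m Bm]]; exists (n + m)%N => _ [y _ <-]; split.
  by apply: An; exists (p%:R ^+ m * y) => //; rewrite exprD mulrA.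
by apply: Bm; exists (p%:R ^+ n * y) => //; rewrite addnC exprD mulrA.
Qed.
Lemma padic_open_bigcup (I : Type) (f : I -> set Zp) :
  (forall i, padic_open (f i)) -> padic_open (\bigcup_i f i).
Proof.
by move=> of_ x [i _ /of_[n fn]]; exists n => y /fn fy; exists i.
Qed.

HB.instance Definition _ := isOpenTopological.Build Zp
  padic_openT padic_openI padic_open_bigcup.

End PadicInt.

Definition padic_num (p : nat) (hp : prime p) := {fraction padic_int hp}.
HB.instance Definition _ p (hp : prime p) := GRing.Field.on (padic_num hp).

(* C_p is given by its defining property, which determines it up to isometric
   isomorphism: an algebraically closed field, complete for a nonarchimedean
   absolute value with |p| = 1/p, with an isometric embedding of Q_p
   (padic_emb_int and |p| = 1/p make padic_emb isometric), and in which the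
   algebraic closure of Q_p is dense. *)
HB.mixin Record isPadicComplex (R : realType) (p : nat) (hp : prime p) C
    & GRing.ClosedField C := {
  padic_abs : C -> R ;
  padic_abs_ge0 : forall x, 0 <= padic_abs x ;
  padic_abs0_eq0 : forall x, padic_abs x = 0 -> x = 0 ;
  padic_absM : forall x y, padic_abs (x * y) = padic_abs x * padic_abs y ;
  padic_absD : forall x y,
    padic_abs (x + y) <= Num.max (padic_abs x) (padic_abs y) ;
  padic_abs_p : padic_abs p%:R = p%:R^-1 ;
  padic_emb : {rmorphism padic_num hp -> C} ;
  padic_emb_int : forall x : padic_int hp,
    padic_abs (padic_emb (@FracField.tofrac _ x)) <= 1 ;
  padic_alg_dense : forall (x : C) (e : R), 0 < e ->
    exists2 y, algebraicOver padic_emb y & padic_abs (x - y) < e ;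
  padic_complete : forall u : nat -> C,
    (forall e : R, 0 < e -> exists N, forall m n, (N <= m)%N -> (N <= n)%N ->
      padic_abs (u m - u n) < e) ->
    exists l, forall e : R, 0 < e -> exists N, forall n, (N <= n)%N ->
      padic_abs (u n - l) < e
}.

#[short(type="padicComplexType")]
HB.structure Definition PadicComplex (R : realType) (p : nat) (hp : prime p) :=
  { C of GRing.ClosedField C & isPadicComplex R p hp C }.

(* The algebra (a, b / F): the element x + y I + z J + t K, where I^2 = a,
   J^2 = b and K = IJ = -JI. *)
Record quat (F : fieldType) (a b : F) := Quat { q1 : F; qI : F; qJ : F; qK : F }.

Section Quat.
Variables (F : fieldType) (a b : F).
Local Notation H := (quat a b).
Implicit Types u v w : H.

Definition quat_tuple u := (q1 u, qI u, qJ u, qK u).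
Definition tuple_quat (t : F * F * F * F) : H := Quat a b t.1.1.1 t.1.1.2 t.1.2 t.2.
Lemma quat_tupleK : cancel quat_tuple tuple_quat. Proof. by case. Qed.
HB.instance Definition _ := Choice.copy H (can_type quat_tupleK).

Definition quat_add u v : H :=
  Quat a b (q1 u + q1 v) (qI u + qI v) (qJ u + qJ v) (qK u + qK v).
Definition quat_opp u : H := Quat a b (- q1 u) (- qI u) (- qJ u) (- qK u).
Definition quat_mul u v : H :=
  let: Quat x y z t := u in let: Quat x' y' z' t' := v in
  Quat a b
    (x * x' + a * (y * y') + b * (z * z') - a * b * (t * t'))
    (x * y' + y * x' - b * (z * t') + b * (t * z'))
    (x * z' + z * x' + a * (y * t') - a * (t * y'))
    (x * t' + t * x' + y * z' - z * y').

Lemma quat_addA : associative quat_add.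
Proof. by move=> u v w; rewrite /quat_add /= !addrA. Qed.
Lemma quat_addC : commutative quat_add.
Proof. by move=> u v; congr Quat; rewrite addrC. Qed.
Lemma quat_add0 : left_id (Quat a b 0 0 0 0) quat_add.
Proof. by case=> x y z t; rewrite /quat_add /= !add0r. Qed.
Lemma quat_addN : left_inverse (Quat a b 0 0 0 0) quat_opp quat_add.
Proof. by move=> u; rewrite /quat_add /= !addNr. Qed.
HB.instance Definition _ := GRing.isZmodule.Build H
  quat_addA quat_addC quat_add0 quat_addN.

Lemma quat_mulA : associative quat_mul.
Proof. by case=> ? ? ? ? [? ? ? ?] [? ? ? ?]; congr Quat; ring. Qed.
Lemma quat_mul1l : left_id (Quat a b 1 0 0 0) quat_mul.
Proof. by case=> ? ? ? ?; congr Quat; ring. Qed.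
Lemma quat_mul1r : right_id (Quat a b 1 0 0 0) quat_mul.
Proof. by case=> ? ? ? ?; congr Quat; ring. Qed.
Lemma quat_mulDl : left_distributive quat_mul quat_add.
Proof. by case=> ? ? ? ? [? ? ? ?] [? ? ? ?]; congr Quat => /=; ring. Qed.
Lemma quat_mulDr : right_distributive quat_mul quat_add.
Proof. by case=> ? ? ? ? [? ? ? ?] [? ? ? ?]; congr Quat => /=; ring. Qed.
Lemma quat_1_neq0 : Quat a b 1 0 0 0 != 0.
Proof. by apply/eqP => -[] /eqP; rewrite oner_eq0. Qed.
HB.instance Definition _ := GRing.Zmodule_isNzRing.Build H
  quat_mulA quat_mul1l quat_mul1r quat_mulDl quat_mulDr quat_1_neq0.

Definition nrd u : F :=
  q1 u ^+ 2 - a * qI u ^+ 2 - b * qJ u ^+ 2 + a * b * qK u ^+ 2.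

Definition is_division : Prop :=
  forall u, u != 0 -> exists v, u * v = 1 /\ v * u = 1.

End Quat.

(* H is ramified at l when H tensored with Q_l is a division algebra. *)
Definition ramified (a b : rat) (l : nat) (hl : prime l) : Prop :=
  @is_division (padic_num hl) (ratr a) (ratr b).

(* D is the product of the primes at which H = (a, b / Q) is ramified. *)
Definition is_discriminant (a b : rat) (D : nat) : Prop :=
  [/\ (0 < D)%N, forall l, prime l -> ~~ (l ^ 2 %| D)%N
    & forall l (hl : prime l), (l %| D)%N <-> ramified a b hl].

Section Orders.
Variables (a b : rat).
Local Notation H := (quat a b).
Implicit Types O : set H.

Definition is_order O : Prop :=
  [/\ O 1,
      forall x y, O x -> O y -> O (x - y),
      forall x y, O x -> O y -> O (x * y),
      exists s : seq H, forall x, O x <->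
        exists c : nat -> int, x = \sum_(i < size s) s`_i *~ c i
    & forall x, exists2 n : nat, (0 < n)%N & O (x *+ n)].

Definition is_maximal_order O : Prop :=
  is_order O /\ forall O', is_order O' -> O `<=` O' -> O' = O.

(* r is a system of representatives of the additive cosets of O in O1. *)
Definition has_index O1 O (n : nat) : Prop :=
  exists r : 'I_n -> H, (forall i, O1 (r i)) /\
    forall x, O1 x -> exists! i, O (x - r i).

(* The level is the index in a maximal order containing O. *)
Definition is_eichler_order O (N : nat) : Prop :=
  exists O1 O2, [/\ is_maximal_order O1, is_maximal_order O2,
    O = O1 `&` O2 & has_index O1 O N].

End Orders.

Section Forms.
Variable R : realType.
Local Notation C := R[i].
Local Notation M2 := 'M[R]_2.

Definition upper_half_plane : set C := [set z | 0 < complex.Im z].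

Definition quat_embed (a b : rat) (w : quat a b) : M2 :=
  let s := Num.sqrt (ratr a) : R in
  let: Quat x y z t := w in
  \matrix_(i, j)
    if i == 0 then (if j == 0 then ratr x + ratr y * s else ratr z + ratr t * s)
    else (if j == 0 then ratr b * (ratr z - ratr t * s) else ratr x - ratr y * s).

Definition Gamma (a b : rat) (O : set (quat a b)) : set M2 :=
  [set quat_embed w | w in O `&` [set w | nrd w = 1]].

Definition cocycle (g : M2) (z : C) : C := (g 1 0)%:C%C * z + (g 1 1)%:C%C.

Definition moebius (g : M2) (z : C) : C :=
  ((g 0 0)%:C%C * z + (g 0 1)%:C%C) / cocycle g z.

Definition slash2 (f : C -> C) (g : M2) (z : C) : C :=
  (\det g)%:C%C * cocycle g z ^- 2 * f (moebius g z).

(* Forms are functions on C of which only the values on the upper half-plane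
   matter; C^o is C as a normed space over itself, so that derivable is
   complex differentiability. *)
Definition holomorphic (f : C -> C) : Prop :=
  forall z, upper_half_plane z -> derivable (f : C^o -> C^o) z 1.

Definition S2 (G : set M2) (f : C -> C) : Prop :=
  holomorphic f /\
  forall g z, G g -> upper_half_plane z -> slash2 f g z = f z.

Definition double_coset (G : set M2) (eta : M2) : set M2 :=
  [set m | exists g h, [/\ G g, G h & m = g *m eta *m h]].

Definition coset_representatives (G : set M2) (eta : M2) (I : finType)
    (gam : I -> M2) : Prop :=
  let orbit i := [set g *m gam i | g in G] in
  double_coset G eta = \bigcup_i orbit i /\ trivIset setT orbit.

Definition hecke (I : finType) (gam : I -> M2) (f : C -> C) (z : C) : C :=
  \sum_i slash2 f (gam i) z.

Definition eigenform (I : finType) (gam : I -> M2) (f : C -> C) (ap : C) : Prop :=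
  (exists2 z, upper_half_plane z & f z != 0) /\
  forall z, upper_half_plane z -> hecke gam f z = ap * f z.

Definition quadratic_imaginary (tau : C) : Prop :=
  upper_half_plane tau /\
  exists P : {poly rat}, [/\ irreducible_poly P, size P = 3%N
    & root (map_poly ratr P) tau].

(* Integral along the straight segment from z to w; for f holomorphic on the
   upper half-plane, any other path there gives the same value. *)
Definition path_integral (f : C -> C) (z w : C) : C :=
  let g (t : R) := f (z + t%:C%C * (w - z)) * (w - z) in
  Complex (\int[lebesgue_measure]_(t in `[0%R, 1%R]) complex.Re (g t))
          (\int[lebesgue_measure]_(t in `[0%R, 1%R]) complex.Im (g t)).

End Forms.

Arguments quat_embed R {a b} w.
Arguments Gamma R {a b} O.

Section Adjunction.
Variable F : fieldType.

Definition is_subfield (K : set F) : Prop :=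
  [/\ K 1, forall x y, K x -> K y -> K (x - y)
    & forall x y, K x -> K y -> K (x / y)].

(* Q(x), for F of characteristic 0 *)
Definition adjoin (x : F) : set F := smallest is_subfield [set x].
Definition in_adjoin (x : F) : {pred F} := fun y => `[< adjoin x y >].

Lemma in_adjoin_closed x : divring_closed (in_adjoin x).
Proof.
split.
- by apply/asboolP => K [[]].
- move=> u v /asboolP Ku /asboolP Kv; apply/asboolP => K KP.
  by case: (KP) => -[_ KB _] _; apply: KB; [exact: Ku|exact: Kv].
- move=> u v /asboolP Ku /asboolP Kv; apply/asboolP => K KP.
  by case: (KP) => -[_ _ KV] _; apply: KV; [exact: Ku|exact: Kv].
Qed.
HB.instance Definition _ x := GRing.isDivringClosed.Build F (in_adjoin x)
  (in_adjoin_closed x).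

Record adjoin_field (x : F) :=
  AdjoinField { adjoin_val :> F; _ : adjoin_val \in in_adjoin x }.
HB.instance Definition _ x := [isSub for @adjoin_val x].
HB.instance Definition _ x := [Choice of adjoin_field x by <:].
HB.instance Definition _ x := [SubChoice_isSubIntegralDomain of adjoin_field x by <:].
HB.instance Definition _ x := [SubIntegralDomain_isSubField of adjoin_field x by <:].

Definition is_subspace (K V : set F) : Prop :=
  V 0 /\ forall c u v, K c -> V u -> V v -> V (c * u + v).

Definition linear_span (K S : set F) : set F := smallest (is_subspace K) S.

End Adjunction.

Section C00.
Variable K : fieldType.

Definition finitely_supported : {pred nat -> K^o} :=
  fun v => `[< finite_set [set i | v i != 0] >].

Lemma finitely_supported_closed : submod_closed finitely_supported.
Proof.
split=> [|c u v /asboolP fu /asboolP fv]; apply/asboolP.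
  by rewrite [X in finite_set X](_ : _ = set0) // -subset0 => i /=; rewrite eqxx.
apply: (@sub_finite_set _ _ ([set i | u i != 0] `|` [set i | v i != 0])).
  move=> i /= cuvi; have [ui|ui] := eqVneq (u i) 0; last by left.
  by right; apply: contra_neq cuvi => vi; rewrite !fctE ui vi scaler0 addr0.
by rewrite finite_setU.
Qed.
HB.instance Definition _ :=
  GRing.isSubmodClosed.Build K (nat -> K^o) finitely_supported
    finitely_supported_closed.

Record c00 := C00 { c00_seq :> nat -> K^o ; _ : c00_seq \in finitely_supported }.
HB.instance Definition _ := [isSub for c00_seq].
HB.instance Definition _ := [Choice of c00 by <:].
HB.instance Definition _ := [SubChoice_isSubLmodule of c00 by <:].

End C00.

Lemma c00_map_subproof (K L : fieldType) (h : {rmorphism K -> L}) (c : c00 K) :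
  (h \o c) \in @finitely_supported L.
Proof.
apply/asboolP; case: c => u /= /asboolP fu.
by apply: sub_finite_set fu => i /=; rewrite fmorph_eq0.
Qed.
Definition c00_map (K L : fieldType) (h : {rmorphism K -> L}) (c : c00 K) : c00 L :=
  C00 (c00_map_subproof h c).

Section Bases.
Variables (F : fieldType) (x : F).
Local Notation K := (adjoin_field x).

(* c is the family of coordinates of w on the family (e i), i in I, of vectors
   of the K-vector space F *)
Definition coordinates (I : set nat) (e : nat -> F) (w : F) (c : c00 K) : Prop :=
  (forall i, ~ I i -> c i = 0) /\ w = \sum_(i \in I) (c i : F) * e i.

Definition is_basis (W : set F) (I : set nat) (e : nat -> F) : Prop :=
  (forall i, I i -> W (e i)) /\ forall w, W w -> exists! c, coordinates I e w c.

(* For a basis (e i), i in I, of W and h : K -> L, the element w of W seen, as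
   w tensor 1, in the tensor product of W and L over K, which the basis
   identifies with a subspace of c00 L. *)
Definition to_c00 (L : fieldType) (h : {rmorphism K -> L}) (I : set nat)
    (e : nat -> F) (w : F) : c00 L :=
  c00_map h (xget 0 [set c | coordinates I e w c]).

End Bases.

Definition is_compact_open (T : topologicalType) (U : set T) : Prop :=
  compact U /\ open U.

(* Only the values on compact open sets matter. *)
Definition is_distribution (T : topologicalType) (V : zmodType)
    (mu : set T -> V) : Prop :=
  forall A B, is_compact_open A -> is_compact_open B -> A `&` B = set0 ->
    mu (A `|` B) = mu A + mu B.

Section Words.
Variables (R : realType) (p : nat).
Local Notation C := R[i].
Implicit Types (gam : 'I_p -> 'M[R]_2) (s : {perm 'I_p}) (f : C -> C).

(* p - i, read modulo p *)
Definition opp_digit (i : 'I_p) : 'I_p :=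
  Ordinal (ltn_pmod (p - i) (leq_ltn_trans (leq0n i) (ltn_ord i))).

(* gam_(d_{n-1}) ... gam_(d_0) *)
Definition word gam n (d : 'I_n -> 'I_p) : 'M[R]_2 :=
  \prod_(i < n) gam (d (rev_ord i)).

Definition word_value gam f (tau : C) n (d : 'I_n -> 'I_p) : C :=
  path_integral f (moebius (word gam d) tau) tau.

Definition mu_value gam s f (tau ap : C) n (d : 'I_n -> 'I_p) : C :=
  ap ^- n * (word_value gam f tau (fun i => s (d i))
           - word_value gam f tau (fun i => s (opp_digit (d i)))).

Definition value_space gam f (tau ap : C) : set C :=
  linear_span (adjoin ap)
    [set w | exists n, exists d : 'I_n -> 'I_p, w = word_value gam f tau d].

(* mu is a distribution on Z_p^*, extended by zero to p Z_p, that takes the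
   prescribed values; val is the map through which these are viewed in V. *)
Definition extends_mu (hp : prime p) (V : zmodType) gam s f (tau ap : C)
    (val : C -> V) (mu : set (padic_int hp) -> V) : Prop :=
  [/\ is_distribution mu,
      forall n (d : 'I_n.+1 -> 'I_p), d ord0 != 0%N :> nat ->
        mu (padic_coset (\sum_(i < n.+1) d i * p ^ i)%N%:R n.+1) =
        val (mu_value gam s f tau ap d),
      mu [set x | x \is a GRing.unit] =
        \sum_(1 <= a < p) mu (padic_coset a%:R 1),
      mu (padic_coset 0 1) = 0
    & forall U, is_compact_open U -> U `<=` padic_coset 0 1 -> mu U = 0].

End Words.

(* Main.v *)
Require Import Defs.
From mathcomp Require Import all_boot all_order perm all_algebra.
From mathcomp Require Import all_classical all_reals all_analysis.
From mathcomp Require Import finmap complex ring lra.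

Set Implicit Arguments.
Unset Strict Implicit.
Unset Printing Implicit Defensive.

Import Order.TTheory GRing.Theory Num.Theory.
Import numFieldNormedType.Exports.
Local Open Scope classical_set_scope.
Local Open Scope ring_scope.

(** The prescribed values extend to a distribution because they refine: the
    value on a coset of level n is the sum of the values on the p cosets of
    level n + 1 into which it splits. Let x be the image of tau under the word
    of a. Refining a by a digit b multiplies the word on the left by a coset
    representative gam_j, where j runs over all indices with b, because sigma
    and i |-> p - i are permutations. Now the sum over j of the integrals of f
    from gam_j x to tau splits, at the points gam_j tau, into the sum of the
    integrals from gam_j x to gam_j tau and a constant that does not depend on
    x. Substituting gam_j turns the former into the integral from x to tau of
    the sum of the f |_2 gam_j, which is T_p f = a_p f. The constant cancels in
    the difference of the two words that defines the value, and the factor a_p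
    is absorbed by the change from a_p^-(n+1) to a_p^-n ([sum_mu_value]).

    The integrals are taken along straight segments, so cutting them at
    gam_j tau requires Goursat's theorem for triangles
    ([path_integral_triangle]): f is only assumed to be complex differentiable
    at each point. It provides a primitive F of f on the upper half-plane, and
    the substitution then says that F o gam_1 + ... + F o gam_p and a_p F are
    primitives of the same function ([path_integral_hecke]).

    On the p-adic side, a compact open set is a union of cosets of one level
    ([compact_open_saturated]). Refinement makes the sum of the values over
    these cosets independent of the level ([level_sum_eq]), hence defines a
    distribution; and additivity leaves no other choice
    ([distribution_level_sum]). Lastly, the coordinate map from complex numbers
    to sequences is additive only on the span of the values, so refinement is
    checked inside this span before it is transported ([to_c00_sum]). *)

(** * Complex derivatives and integrals along segments *)

Section EpsilonDelta.
Variable K : numFieldType.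
Implicit Types (g : K -> K) (x d : K).

(** The form without division, in which the increment h = 0 needs no separate
    treatment and in which real and complex derivatives can be compared. *)
Lemma is_derive_epsP (g : K -> K) (x d : K) :
  is_derive (x : K^o) 1 (g : K^o -> K^o) (d : K^o) <->
  forall e : K, 0 < e -> exists2 r : K, 0 < r & forall h, `|h| < r ->
    `|g (x + h) - g x - d * h| <= e * `|h|.
Proof.
pose q (h : K) : K^o := h^-1 *: (((g : K^o -> K^o) \o shift (x : K^o)) (h *: (1 : K^o)) - g x).
have quotE (h : K) : h != 0 ->
    `|d - q h| * `|h| = `|g (x + h) - g x - d * h|.
  move=> h0; rewrite -normrM mulrBl /q /=.
  have -> : h *: (1 : K^o) = h by exact: mulr1.
  have -> : h^-1 *: (g (h + x) - g x : K^o) = h^-1 * (g (h + x) - g x) by [].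
  by rewrite mulrAC mulVf // mul1r distrC (addrC h).
have cvgq : q h @[h --> (0 : K)^'] --> (d : K^o) <->
    forall e : K, 0 < e -> exists2 r : K, 0 < r & forall h, `|h| < r ->
    `|g (x + h) - g x - d * h| <= e * `|h|.
  split.
    move/cvgrPdist_le => qd e e0.
    have /nbhs_ballP[r /= r0 rP] := qd e e0.
    exists r => // h hr; have [->|h0] := eqVneq h 0.
      by rewrite addr0 subrr mulr0 subr0 !normr0 mulr0.
    rewrite -quotE // ler_wpM2r // rP //.
    by rewrite /ball /= sub0r normrN.
  move=> H; apply/cvgrPdist_le => e e0.
  have [r r0 rP] := H e e0; apply/nbhs_ballP; exists r => //= h.
  rewrite /ball /= sub0r normrN => hr h0.
  by rewrite -(@ler_pM2r _ `|h|) ?normr_gt0 // quotE // rP.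
split.
  move=> [+ dE]; rewrite /derivable => /= gx; apply/cvgq; rewrite -dE.
  exact: gx.
move=> /cvgq qd; apply: DeriveDef; last exact: (cvg_lim _ qd).
by apply/cvg_ex; exists d.
Qed.

End EpsilonDelta.

Section PathIntegral.
Variable R : realType.
Local Notation C := R[i].
Local Notation normc := (@ComplexField.Normc.normc R).
Local Notation H := (@upper_half_plane R).
Implicit Types (f F A : C -> C) (x y z u : C) (t : R).

Lemma complex_ReIm z : Complex (complex.Re z) (complex.Im z) = z.
Proof. by case: z. Qed.

Lemma norm_normc z : `|z| = (normc z)%:C%C. Proof. by []. Qed.

Lemma normc_ge0 z : 0 <= normc z.
Proof. by case: z => a b; exact: sqrtr_ge0. Qed.

Lemma normcD x y : normc (x + y) <= normc x + normc y.
Proof. exact: le_normcD. Qed.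

Lemma Re_normc z : `|complex.Re z| <= normc z.
Proof. by case: z => a b /=; rewrite -sqrtr_sqr ler_sqrt ?lerDl ?addr_ge0 ?sqr_ge0. Qed.

Lemma Im_normc z : `|complex.Im z| <= normc z.
Proof. by case: z => a b /=; rewrite -sqrtr_sqr ler_sqrt ?lerDr ?addr_ge0 ?sqr_ge0. Qed.

Lemma normc_le_ReIm z : normc z <= `|complex.Re z| + `|complex.Im z|.
Proof.
case: z => a b /=; rewrite -[leRHS]ger0_norm ?addr_ge0 // -sqrtr_sqr ler_sqrt ?sqr_ge0 //.
by rewrite sqrrD !real_normK ?num_real // addrAC lerDl mulrn_wge0 // mulr_ge0.
Qed.

Lemma normc_real t : normc t%:C%C = `|t|.
Proof. by rewrite /= expr0n addr0 sqrtr_sqr. Qed.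

Lemma Re_mul_real z t : complex.Re (z * t%:C%C) = complex.Re z * t.
Proof. by case: z => a b /=; rewrite mulr0 subr0. Qed.

Lemma Im_mul_real z t : complex.Im (z * t%:C%C) = complex.Im z * t.
Proof. by case: z => a b /=; rewrite mulr0 add0r. Qed.

Lemma continuous_Re : continuous (@complex.Re R : C^o -> R^o).
Proof.
move=> z; apply/(@cvgrPdist_lt _ _ _ (nbhs z) (nbhs_filter z)) => e e0; apply/nbhs_ballP.
exists e%:C%C => [|w]; first by rewrite /= ltcR.
rewrite /ball /= norm_normc ltcR; apply: le_lt_trans.
by rewrite -raddfB; exact: Re_normc.
Qed.

Lemma continuous_Im : continuous (@complex.Im R : C^o -> R^o).
Proof.
move=> z; apply/(@cvgrPdist_lt _ _ _ (nbhs z) (nbhs_filter z)) => e e0; apply/nbhs_ballP.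
exists e%:C%C => [|w]; first by rewrite /= ltcR.
rewrite /ball /= norm_normc ltcR; apply: le_lt_trans.
by rewrite -raddfB; exact: Im_normc.
Qed.

Lemma continuous_real_complex : continuous (fun t : R^o => t%:C%C : C^o).
Proof.
move=> t; apply/cvgrPdist_lt => e; rewrite ltcE => /andP[/eqP e0 e1].
apply/nbhs_ballP; exists (complex.Re e) => //= s; rewrite /ball /= => ts.
by rewrite -rmorphB norm_normc normc_real ltcE /= e0 eqxx.
Qed.

(** Integrands are extended to the whole line by their end values, so that
    continuity and derivatives at 0 and 1 need not be one-sided. *)
Definition clamp t : R := Num.max 0 (Num.min t 1).

Lemma clamp01 t : 0 <= clamp t <= 1.
Proof. by rewrite /clamp le_max lexx ge_max ler01 ge_min lexx orbT. Qed.

Lemma clamp_id t : 0 <= t <= 1 -> clamp t = t.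
Proof. by move=> /andP[t0 t1]; rewrite /clamp min_l // max_r. Qed.

Lemma continuous_clamp : continuous (clamp : R^o -> R^o).
Proof.
move=> t; apply: (@continuous_max _ _ (cst 0) (fun s : R^o => Num.min s 1)).
  exact: cst_continuous.
by apply: (@continuous_min _ _ id (cst 1)); [exact: cvg_id|exact: cst_continuous].
Qed.

(** The integral starts at -1 because the fundamental theorem only gives the
    derivative at points interior to the interval of integration. *)
Lemma continuous_primitive (g : R -> R) : continuous (g : R^o -> R^o) ->
  exists G : R -> R, forall t, 0 <= t <= 1 -> is_derive t 1 G (g t).
Proof.
move=> cg; exists (fun t => \int[lebesgue_measure]_(s in `[-1, t]) g s) => t t01.
have ig : lebesgue_measure.-integrable `[-1, 2%:R] (EFin \o g).
  apply: continuous_compact_integrable; first exact: segment_compact.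
  by apply: continuous_subspaceT.
have [||dG GE] := continuous_FTC1_closed (x := t) _ ig _ (cg t); try lra.
by apply: DeriveDef; [exact: dG|rewrite -derive1E; exact: GE].
Qed.

(** The plane of complex numbers is not used as a real normed space: the
    derivative of a curve is taken on its two coordinates. *)
Definition path_derive (G : R -> C) t (d : C) : Prop :=
  is_derive t 1 (fun s => complex.Re (G s)) (complex.Re d) /\
  is_derive t 1 (fun s => complex.Im (G s)) (complex.Im d).

Lemma integral_primitive01 (g gc G : R -> R) : continuous (gc : R^o -> R^o) ->
  (forall t, 0 <= t <= 1 -> g t = gc t) ->
  (forall t, 0 <= t <= 1 -> is_derive t 1 G (g t)) ->
  \int[lebesgue_measure]_(t in `[0%R, 1%R]) g t = G 1 - G 0.
Proof.
move=> cgc gE dG.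
have -> : \int[lebesgue_measure]_(t in `[0%R, 1%R]) g t =
    \int[lebesgue_measure]_(t in `[0%R, 1%R]) gc t.
  by apply: eq_Rintegral => t; rewrite in_setE /= in_itv /= => /gE.
have cG t : 0 <= t <= 1 -> {for t, continuous (G : R^o -> R^o)}.
  move=> /dG [dGt _]; apply: differentiable_continuous.
  exact/derivable1_diffP.
rewrite /Rintegral (@continuous_FTC2 _ gc G 0 1) //.
- exact: continuous_subspaceT.
- split.
  + by move=> t; rewrite in_itv /= => /andP[t0 t1]; have [] := dG t; rewrite ?ltW.
  + by apply: cvg_at_right_filter; apply: cG; rewrite lexx ler01.
  + by apply: cvg_at_left_filter; apply: cG; rewrite lexx ler01.
- move=> t; rewrite in_itv /= => /andP[t0 t1].
  have t01 : 0 <= t <= 1 by rewrite !ltW.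
  by have [_] := dG t t01; rewrite derive1E gE.
Qed.

Definition segment x y t : C := x + t%:C%C * (y - x).

Lemma upper_half_plane_segment x y t : H x -> H y -> 0 <= t <= 1 ->
  H (segment x y t).
Proof.
case: x => a b; case: y => c d; rewrite /upper_half_plane /segment /= => b0 d0 t01.
by rewrite mul0r addr0; nra.
Qed.

Lemma segment_derive A (a : C) x y t :
  is_derive (segment x y t : C^o) 1 (A : C^o -> C^o) a ->
  path_derive (fun s => A (segment x y s)) t (a * (y - x)).
Proof.
move=> /is_derive_epsP dA.
have eps (e : R) : 0 < e -> exists2 r : R, 0 < r & forall h, `|h| < r ->
    normc (A (segment x y (t + h)) - A (segment x y t) - a * (y - x) * h%:C%C)
      <= e * `|h|.
  move=> e0; pose k := normc (y - x) + 1.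
  have k0 : 0 < k by rewrite ltr_pwDr // normc_ge0.
  have [|r] := dA (e / k)%:C%C; first by rewrite ltcR divr_gt0.
  case: r => r ri; rewrite ltcE /= => /andP[/eqP -> r0] rP.
  exists (r / k); first exact: divr_gt0.
  move=> h hr; have /rP : `|h%:C%C * (y - x)| < r%:C%C.
    rewrite norm_normc ltcR ComplexField.Normc.normcM normc_real.
    apply: le_lt_trans (_ : `|h| * k < _); last by rewrite -ltr_pdivlMr.
    by rewrite ler_wpM2l // lerDl.
  rewrite !norm_normc -rmorphM lecR.
  have -> : segment x y t + h%:C%C * (y - x) = segment x y (t + h).
    by rewrite /segment rmorphD mulrDl addrA.
  rewrite -mulrA (mulrC (y - x)) => /le_trans -> //.
  rewrite ComplexField.Normc.normcM normc_real -mulrA ler_pM2l // mulrCA.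
  by rewrite ler_piMr // ler_pdivrMl // mulr1 lerDl.
split; apply/(@is_derive_epsP R) => e /eps[r r0 rP]; exists r => // h /rP;
  apply: le_trans; [apply: le_trans (Re_normc _)|apply: le_trans (Im_normc _)].
- by rewrite !raddfB /= Re_mul_real.
- by rewrite !raddfB /= Im_mul_real.
Qed.

Section Continuous.
Variables (f : C -> C).
Hypothesis fc : forall z, H z -> {for z, continuous (f : C^o -> C^o)}.

Let integrand x y t : C := f (segment x y (clamp t)) * (y - x).

Let continuous_integrand x y : H x -> H y ->
  continuous (integrand x y : R^o -> C^o).
Proof.
move=> Hx Hy t; rewrite /integrand.
apply: (@cvgM _ _ (nbhs t) _ (fun s : R => f (segment x y (clamp s))) (cst (y - x)));
  last exact: cvg_cst.
apply: (@cvg_comp _ _ _ (fun s : R => segment x y (clamp s)) f (nbhs t)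
  (nbhs (segment x y (clamp t) : C^o))); last first.
  exact/fc/upper_half_plane_segment/clamp01.
apply: (@cvgD _ C^o _ (nbhs t) _ (cst x) (fun s => (clamp s)%:C%C * (y - x)));
  first exact: cvg_cst.
apply: (@cvgM _ _ (nbhs t) _ (fun s : R => (clamp s)%:C%C) (cst (y - x))); last exact: cvg_cst.
apply: (@cvg_comp _ _ _ clamp (fun s => s%:C%C) (nbhs t) (nbhs (clamp t : R^o))).
  exact: continuous_clamp.
exact: continuous_real_complex.
Qed.

Let integrand01 x y t : 0 <= t <= 1 ->
  f (segment x y t) * (y - x) = integrand x y t.
Proof. by move=> t01; rewrite /integrand clamp_id. Qed.

Lemma path_integral_primitive x y (G : R -> C) : H x -> H y ->
  (forall t, 0 <= t <= 1 -> path_derive G t (f (segment x y t) * (y - x))) ->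
  path_integral f x y = G 1 - G 0.
Proof.
move=> Hx Hy dG; have ci := continuous_integrand Hx Hy.
rewrite -(complex_ReIm (G 1 - G 0)) !raddfB /path_integral; congr Complex.
- apply: (@integral_primitive01 _ (fun t => complex.Re (integrand x y t))
    (fun t => complex.Re (G t))).
  + by move=> t; apply: cvg_comp (ci t) _; exact: continuous_Re.
  + by move=> t t01; rewrite -integrand01.
  + by move=> t /dG [].
- apply: (@integral_primitive01 _ (fun t => complex.Im (integrand x y t))
    (fun t => complex.Im (G t))).
  + by move=> t; apply: cvg_comp (ci t) _; exact: continuous_Im.
  + by move=> t t01; rewrite -integrand01.
  + by move=> t /dG [].
Qed.

Lemma segment_primitive x y : H x -> H y -> exists G : R -> C,
  forall t, 0 <= t <= 1 -> path_derive G t (f (segment x y t) * (y - x)).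
Proof.
move=> Hx Hy; have ci := continuous_integrand Hx Hy.
have [|G1 dG1] := @continuous_primitive (fun t => complex.Re (integrand x y t)).
  by move=> t; apply: cvg_comp (ci t) _; exact: continuous_Re.
have [|G2 dG2] := @continuous_primitive (fun t => complex.Im (integrand x y t)).
  by move=> t; apply: cvg_comp (ci t) _; exact: continuous_Im.
exists (fun t => Complex (G1 t) (G2 t)) => t t01; rewrite integrand01 //.
by split; [exact: dG1|exact: dG2].
Qed.

(** One primitive along the segment computes the integrals over all its
    sub-segments, in both directions; reversal and subdivision are special
    cases. *)
Lemma path_integral_sub x y : H x -> H y -> exists G : R -> C,
  forall a b, 0 <= a <= 1 -> 0 <= b <= 1 ->
    path_integral f (segment x y a) (segment x y b) = G b - G a.
Proof.
move=> Hx Hy; have [G dG] := segment_primitive Hx Hy.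
exists G => a b a01 b01.
rewrite (@path_integral_primitive _ _ (fun t => G (a + t * (b - a)))).
- by rewrite mul1r mul0r addr0 subrKC.
- exact: upper_half_plane_segment.
- exact: upper_half_plane_segment.
move=> t t01; have abt : 0 <= a + t * (b - a) <= 1 by nra.
have da : is_derive t 1 (fun s => a + s * (b - a)) (b - a).
  apply/(@is_derive_epsP R) => e e0; exists 1 => // h _.
  suff -> : a + (t + h) * (b - a) - (a + t * (b - a)) - (b - a) * h = 0.
    by rewrite normr0 mulr_ge0 // ltW.
  by ring.
have segE : segment (segment x y a) (segment x y b) t = segment x y (a + t * (b - a)).
  by rewrite /segment rmorphD rmorphM rmorphB; ring.
have subE : segment x y b - segment x y a = (y - x) * (b - a)%:C%C.
  by rewrite /segment rmorphB; ring.
rewrite segE subE mulrA; have [dG1 dG2] := dG _ abt.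
split; [rewrite Re_mul_real|rewrite Im_mul_real].
- exact: (@is_derive1_comp _ (fun s => complex.Re (G s))
    (fun s => a + s * (b - a)) t _ _ dG1 da).
- exact: (@is_derive1_comp _ (fun s => complex.Im (G s))
    (fun s => a + s * (b - a)) t _ _ dG2 da).
Qed.

(** The mean value theorem, applied to the difference between a primitive of f
    along the segment and A. The factor 2 comes from treating the real and the
    imaginary part separately. Taking A affine or quadratic gives the local
    estimates below, and M = 0 gives the fundamental theorem of calculus. *)
Lemma path_integral_approx A A' x y (M : R) : H x -> H y ->
  (forall z, H z -> is_derive (z : C^o) 1 (A : C^o -> C^o) (A' z)) ->
  (forall t, 0 <= t <= 1 -> normc (f (segment x y t) - A' (segment x y t)) <= M) ->
  normc (path_integral f x y - (A y - A x)) <= 2 * M * normc (y - x).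
Proof.
move=> Hx Hy dA leM; have [G dG] := segment_primitive Hx Hy.
rewrite (path_integral_primitive Hx Hy dG).
pose D t := G t - A (segment x y t).
pose d t := (f (segment x y t) - A' (segment x y t)) * (y - x).
have dD t : 0 <= t <= 1 -> path_derive D t (d t).
  move=> t01; have [dG1 dG2] := dG _ t01.
  have [dA1 dA2] := segment_derive (dA _ (upper_half_plane_segment Hx Hy t01)).
  rewrite /path_derive /d mulrBl !raddfB.
  have -> : (fun s => complex.Re (D s)) = (fun s => complex.Re (G s)) -
      (fun s => complex.Re (A (segment x y s))) by apply/funext => s; rewrite raddfB.
  have -> : (fun s => complex.Im (D s)) = (fun s => complex.Im (G s)) -
      (fun s => complex.Im (A (segment x y s))) by apply/funext => s; rewrite raddfB.
  by split; [apply: (is_deriveB dG1 dA1)|apply: (is_deriveB dG2 dA2)].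
have -> : G 1 - G 0 - (A y - A x) = D 1 - D 0.
  rewrite /D /segment rmorph1 rmorph0 mul1r mul0r addr0 subrKC; ring.
have M' t : 0 <= t <= 1 -> normc (d t) <= M * normc (y - x).
  by move=> t01; rewrite ComplexField.Normc.normcM ler_wpM2r ?normc_ge0 ?leM.
have mvt (g h : R -> R) : (forall t, 0 <= t <= 1 -> is_derive t 1 g (h t)) ->
    (forall t, 0 <= t <= 1 -> `|h t| <= M * normc (y - x)) ->
    `|g 1 - g 0| <= M * normc (y - x).
  move=> dg hM; have [||c] := @MVT R g h 0 1 ltr01.
  - by move=> t; rewrite in_itv /= => /andP[t0 t1]; apply: dg; rewrite !ltW.
  - apply: derivable_within_continuous => t; rewrite in_itv /= => /dg[] //.
  - rewrite in_itv /= => /andP[c0 c1] ->.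
    by rewrite subr0 mulr1 hM // !ltW.
apply: le_trans (normc_le_ReIm _) _.
rewrite -mulrA mulr_natl mulr2n (raddfB _ (D 1)) (raddfB (@complex.Im R) (D 1)) lerD //.
- apply: (mvt (fun t => complex.Re (D t)) (fun t => complex.Re (d t))) => t t01.
    by have [] := dD t t01.
  exact: le_trans (Re_normc _) (M' _ t01).
- apply: (mvt (fun t => complex.Im (D t)) (fun t => complex.Im (d t))) => t t01.
    by have [] := dD t t01.
  exact: le_trans (Im_normc _) (M' _ t01).
Qed.

End Continuous.

End PathIntegral.

(** * Goursat's theorem *)

Section Goursat.
Variable R : realType.
Local Notation C := R[i].
Local Notation normc := (@ComplexField.Normc.normc R).
Local Notation H := (@upper_half_plane R).

Lemma normcB (x y : C) : normc (x - y) = normc (y - x).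
Proof. by rewrite -opprB; exact: normcN. Qed.

(** The sequences u_n - 2 K / 2^n and u_n + 2 K / 2^n are monotone and enclose
    the limit. *)
Lemma geometric_limit (u : nat -> R) (K : R) :
  (forall n, `|u n.+1 - u n| <= K * 2^-1 ^+ n) ->
  exists c, forall n, `|u n - c| <= 2 * K * 2^-1 ^+ n.
Proof.
move=> uK; have K0 n : 0 <= K * 2^-1 ^+ n by apply: le_trans (uK n).
have step n : - (K * 2^-1 ^+ n) <= u n.+1 - u n <= K * 2^-1 ^+ n.
  by rewrite -ler_norml.
have lo n k : u n - 2 * K * 2^-1 ^+ n <= u (k + n)%N - 2 * K * 2^-1 ^+ (k + n).
  elim: k => // k; move: (step (k + n)%N); rewrite addSn exprS; lra.
have hi n k : u (k + n)%N + 2 * K * 2^-1 ^+ (k + n) <= u n + 2 * K * 2^-1 ^+ n.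
  elim: k => // k; move: (step (k + n)%N); rewrite addSn exprS; lra.
pose S := range (fun n => u n - 2 * K * 2^-1 ^+ n).
have ubS n : ubound S (u n + 2 * K * 2^-1 ^+ n).
  move=> _ [m _ <-]; have := lo m n; have := hi n m; have := K0 (n + m)%N.
  rewrite addnC; lra.
have hS : has_sup S.
  split; first by exists (u 0%N - 2 * K * 2^-1 ^+ 0); exists 0%N.
  by exists (u 0%N + 2 * K * 2^-1 ^+ 0); exact: ubS.
exists (sup S) => n; rewrite ler_norml.
have h1 : u n - 2 * K * 2^-1 ^+ n <= sup S by apply: sup_upper_bound => //; exists n.
have h2 : sup S <= u n + 2 * K * 2^-1 ^+ n by apply: ge_sup; [case: hS|exact: ubS].
lra.
Qed.

Variable f : C -> C.
Hypothesis fH : holomorphic f.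

Lemma holomorphic_continuous z : H z -> {for z, continuous (f : C^o -> C^o)}.
Proof.
move=> /fH df; apply: differentiable_continuous; exact/derivable1_diffP.
Qed.
Let fc := holomorphic_continuous.
Local Notation I := (path_integral f).

Let midpoint (x y : C) := segment x y 2^-1.

Lemma segment0 (x y : C) : segment x y 0 = x.
Proof. by rewrite /segment rmorph0 mul0r addr0. Qed.
Lemma segment1 (x y : C) : segment x y 1 = y.
Proof. by rewrite /segment rmorph1 mul1r subrKC. Qed.

Let half01 : (0 : R) <= (2^-1 : R) <= 1.
Proof. by rewrite invr_ge0 ler0n invf_le1 ?ler1n ?ltr0n. Qed.

Lemma path_integral_opp x y : H x -> H y -> I y x = - I x y.
Proof.
move=> Hx Hy; have [G GE] := path_integral_sub fc Hx Hy.
have := GE 0 1; have := GE 1 0; rewrite segment0 segment1 !lexx !ler01.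
by move=> -> // -> //; rewrite opprB.
Qed.

Lemma path_integral_split x y : H x -> H y ->
  I x y = I x (midpoint x y) + I (midpoint x y) y.
Proof.
move=> Hx Hy; have [G GE] := path_integral_sub fc Hx Hy.
have := GE 0 1; have := GE 0 2^-1; have := GE 2^-1 1.
rewrite segment0 segment1 !lexx !ler01 half01.
by move=> -> // -> // -> //; ring.
Qed.

Let triangle (t : C * C * C) := I t.1.1 t.1.2 + I t.1.2 t.2 + I t.2 t.1.1.
Let perimeter (t : C * C * C) :=
  normc (t.1.2 - t.1.1) + normc (t.2 - t.1.2) + normc (t.1.1 - t.2).
Let above (m : R) (t : C * C * C) :=
  [/\ m <= complex.Im t.1.1, m <= complex.Im t.1.2 & m <= complex.Im t.2].

Let midE x y : midpoint x y = (x + y) / 2.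
Proof.
rewrite /midpoint /segment fmorphV rmorph_nat; by field.
Qed.

Let above_mid m x y : m <= complex.Im x -> m <= complex.Im y ->
  m <= complex.Im (midpoint x y).
Proof.
rewrite /midpoint /segment; case: x => a b; case: y => c d /=; rewrite mul0r addr0; lra.
Qed.

Let normc_half (x : C) : normc (x / 2) = normc x / 2.
Proof.
rewrite ComplexField.Normc.normcM ComplexField.Normc.normcV.
by rewrite -[2 : C](rmorph_nat (@real_complex R)) normc_real ger0_norm.
Qed.

(** The midpoints of the sides cut the triangle into four triangles of half the
    perimeter; the integrals over the inner sides cancel, so one of the four
    carries at least a quarter of the integral. *)
Let subdivide m t : 0 < m -> above m t -> exists t', [/\ above m t',
  perimeter t' = perimeter t / 2, normc (t'.1.1 - t.1.1) <= perimeter t &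
  normc (triangle t) <= 4 * normc (triangle t')].
Proof.
move=> m0; case: t => [[x y] z] [/= mx my mz].
have Hm w : m <= complex.Im w -> H w by apply: lt_le_trans.
pose a := midpoint x y; pose b := midpoint y z; pose c := midpoint z x.
have [ma mb mc] : [/\ m <= complex.Im a, m <= complex.Im b & m <= complex.Im c].
  by split; exact: above_mid.
pose t1 := (x, a, c); pose t2 := (a, y, b); pose t3 := (c, b, z); pose t4 := (b, c, a).
have half2 (u v : C) : u = v / 2 \/ u = - (v / 2) -> normc u = normc v / 2.
  by move=> [->|->]; rewrite -normc_half //; exact: normcN.
have two0 : 2 != 0 :> C by rewrite pnatr_eq0.
have per t' : t' \in [:: t1; t2; t3; t4] -> perimeter t' = perimeter (x, y, z) / 2.
  rewrite !inE /perimeter => /or4P[] /eqP ->; rewrite /t1 /t2 /t3 /t4 /= !mulrDl;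
  by congr (_ + _ + _); apply: half2; rewrite /a /b /c !midE;
    first [by left; field|by right; field].
have TE : triangle (x, y, z) = triangle t1 + triangle t2 + triangle t3 + triangle t4.
  rewrite /triangle /t1 /t2 /t3 /t4 /=.
  rewrite (path_integral_split (Hm _ mx) (Hm _ my)) (path_integral_split (Hm _ my) (Hm _ mz)).
  rewrite (path_integral_split (Hm _ mz) (Hm _ mx)) -/a -/b -/c.
  rewrite (path_integral_opp (Hm _ mc) (Hm _ ma)) (path_integral_opp (Hm _ mb) (Hm _ mc)).
  by rewrite (path_integral_opp (Hm _ ma) (Hm _ mb)); ring.
have [t' t'in t'T] : exists2 t', t' \in [:: t1; t2; t3; t4] &
    normc (triangle (x, y, z)) <= 4 * normc (triangle t').
  apply: contrapT => no.
  have lt t' : t' \in [:: t1; t2; t3; t4] ->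
      4 * normc (triangle t') < normc (triangle (x, y, z)).
    by move=> t'in; rewrite ltNge; apply/negP => le; apply: no; exists t'.
  have := lt t1; have := lt t2; have := lt t3; have := lt t4.
  rewrite !inE !eqxx !orbT => /(_ isT) l4 /(_ isT) l3 /(_ isT) l2 /(_ isT) l1.
  have := normcD (triangle t1 + triangle t2 + triangle t3) (triangle t4).
  have := normcD (triangle t1 + triangle t2) (triangle t3).
  have := normcD (triangle t1) (triangle t2).
  rewrite -TE; lra.
have [nx ny nz] : [/\ normc (a - x) = normc (y - x) / 2,
    normc (c - x) = normc (x - z) / 2 &
    normc (b - x) <= normc (y - x) / 2 + normc (x - z) / 2].
  have ax : normc (a - x) = normc (y - x) / 2.
    by apply: half2; left; rewrite /a midE; field.
  have cx : normc (c - x) = normc (x - z) / 2.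
    by apply: half2; right; rewrite /c midE; field.
  split => //; rewrite -ax -cx; apply: le_trans (normcD _ _).
  suff -> : b - x = a - x + (c - x) by [].
  by rewrite /a /b /c !midE; field.
have p0 := (normc_ge0 (y - x), normc_ge0 (z - y), normc_ge0 (x - z)).
exists t'; split=> //; last first.
- move: t'in; rewrite !inE /perimeter => /or4P[] /eqP -> /=.
  + by rewrite subrr ComplexField.Normc.normc0 !addr_ge0 ?p0.
  + move: p0 => [[]]; rewrite nx; lra.
  + move: p0 => [[]]; rewrite ny; lra.
  + move: p0 => [[]]; lra.
- exact: per.
- by move: t'in; rewrite !inE => /or4P[] /eqP ->.
Qed.

(** The quadratic primitive of the first order expansion of f at c. *)
Let affine_primitive (c u v : C) : exists A, forall z : C,
  is_derive (z : C^o) 1 (A : C^o -> C^o) (u + v * (z - c)).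
Proof.
pose w := v / 2; exists (fun z => u * z + w * (z - c) ^+ 2) => z.
apply/is_derive_epsP => e e0; have w0 : 0 < `|w| + 1 by rewrite ltr_wpDl.
exists (e / (`|w| + 1)) => [|h hr]; first exact: divr_gt0.
set d := (X in `|X|); have -> : d = w * h * h by rewrite /d /w; field.
rewrite 2!normrM ler_wpM2r //; apply: le_trans (_ : (`|w| + 1) * `|h| <= _).
  by rewrite ler_wpM2r // lerDl.
by rewrite -ler_pdivlMl // mulrC ltW.
Qed.

(** Goursat's argument. Repeated subdivision gives triangles shrinking to a
    point c, the n-th of perimeter P / 2^n and with an integral of at least
    4^-n times the initial one. Near c the function f differs from its affine
    part, which has a primitive, by less than e |z - c|; so the n-th integral
    is at most a constant times e (P / 2^n)^2. The powers of 4 cancel, and e is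
    arbitrary. The imaginary parts of the vertices stay above those of the
    initial triangle, which keeps c in the upper half-plane. *)
Lemma path_integral_triangle x y z : H x -> H y -> H z ->
  I x y + I y z + I z x = 0.
Proof.
move=> Hx Hy Hz; pose t0 := (x, y, z).
pose m := Num.min (complex.Im x) (Num.min (complex.Im y) (complex.Im z)).
have m0 : 0 < m by rewrite !lt_min; apply/and3P; split.
have mt0 : above m t0 by split; rewrite /= !ge_min lexx ?orbT.
have /choice[next nextP] (t : C * C * C) : exists t', above m t -> [/\ above m t',
    perimeter t' = perimeter t / 2, normc (t'.1.1 - t.1.1) <= perimeter t &
    normc (triangle t) <= 4 * normc (triangle t')].
  have [mt|nmt] := pselect (above m t); last by exists t.
  by have [t' t'P] := subdivide m0 mt; exists t'.
pose T n := iter n next t0; pose P := perimeter t0.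
have mT n : above m (T n) by elim: n => // n /nextP[].
have PT n : perimeter (T n) = P * 2^-1 ^+ n.
  elim: n => [|n IH]; first by rewrite expr0 mulr1.
  by have [_ -> _ _] := nextP _ (mT n); rewrite IH exprSr mulrA.
have stepT n : normc ((T n.+1).1.1 - (T n).1.1) <= P * 2^-1 ^+ n.
  by rewrite -PT; have [] := nextP _ (mT n).
have bigT n : normc (triangle t0) <= 4 ^+ n * normc (triangle (T n)).
  elim: n => [|n IH]; first by rewrite expr0 mul1r.
  apply: le_trans IH _; rewrite exprSr -mulrA ler_pM2l ?exprn_gt0 //.
  by have [] := nextP _ (mT n).
have [c1 c1P] : exists c, forall n, `|complex.Re (T n).1.1 - c| <= 2 * P * 2^-1 ^+ n.
  apply: geometric_limit => n; rewrite -raddfB.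
  exact: le_trans (Re_normc _) (stepT n).
have [c2 c2P] : exists c, forall n, `|complex.Im (T n).1.1 - c| <= 2 * P * 2^-1 ^+ n.
  apply: geometric_limit => n; rewrite -raddfB.
  exact: le_trans (Im_normc _) (stepT n).
have P0 : 0 <= P by rewrite /P /perimeter !addr_ge0 ?normc_ge0.
have small (r : R) : 0 < r -> exists n, P * 2^-1 ^+ n < r.
  move=> r0; have := @cvg_geometric R P 2^-1.
  rewrite gtr0_norm ?invr_gt0 // invf_lt1 // ltr1n => /(_ isT) /cvgrPdist_lt /(_ r r0).
  case=> N _ /(_ N (leqnn N)); rewrite /geometric /= sub0r normrN => h.
  by exists N; apply: le_lt_trans (ler_norm _) h.
pose c := Complex c1 c2.
have cT n : normc ((T n).1.1 - c) <= 4 * (P * 2^-1 ^+ n).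
  apply: le_trans (normc_le_ReIm _) _; rewrite !raddfB /=.
  move: (c1P n) (c2P n); rewrite -!mulrA; set u := P * _; lra.
have Hc : H c.
  apply: lt_le_trans m0 _ => /=; apply/ler_addgt0Pr => e e0.
  have [n nP] := small (e / 2) ltac:(by rewrite divr_gt0).
  have [mn _ _] := mT n; have := ler_norm (complex.Im (T n).1.1 - c2).
  have := c2P n; move: nP; rewrite -mulrA; set u := P * _; lra.
have [d /is_derive_epsP dP] : exists d, is_derive (c : C^o) 1 (f : C^o -> C^o) d.
  by exists ('D_1 (f : C^o -> C^o) (c : C^o)); apply/derivableP/fH.
have [A dA] := affine_primitive c (f c) d.
suff le e : 0 < e -> normc (triangle t0) <= 36 * P ^+ 2 * e.
  have T0 : normc (triangle t0) <= 0.
    apply/ler_addgt0Pr => e e0; rewrite add0r.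
    have k0 : 0 < 36 * P ^+ 2 + 1 by rewrite ltr_wpDl // mulr_ge0 ?sqr_ge0.
    have := le (e / (36 * P ^+ 2 + 1)); rewrite divr_gt0 // => /(_ isT) /le_trans -> //.
    by rewrite mulrCA ler_piMr ?(ltW e0) // ler_pdivrMr // mul1r lerDl.
  by apply: ComplexField.Normc.eq0_normc; apply/eqP; rewrite eq_le T0 normc_ge0.
move=> e0; have [|r] := dP e%:C%C; first by rewrite ltcR.
case: r => r ri; rewrite ltcE /= => /andP[/eqP -> r0] rP {ri}.
(* Points of the n-th triangle are within 6 P / 2^n of c: the first vertex is
   within 4 P / 2^n, and a point of a side is at most two sides away from it. *)
have [n nr] := small (r / 6) ltac:(by rewrite divr_gt0).
set Pn := P * 2^-1 ^+ n in nr; have Pn0 : 0 <= Pn by rewrite mulr_ge0 // exprn_ge0.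
pose T3 := triangle (T n).
have side v w : H v -> H w -> normc (v - (T n).1.1) <= Pn -> normc (w - v) <= Pn ->
    normc (I v w - (A w - A v)) <= 12 * e * Pn * Pn.
  move=> Hv Hw vT wv.
  apply: le_trans (path_integral_approx (M := 6 * e * Pn) fc Hv Hw (fun z _ => dA z) _) _.
    move=> s s01; set q := segment v w s.
    have qc : normc (q - c) <= 6 * Pn.
      have qv : normc (q - v) <= Pn.
        rewrite /q /segment addrC addKr ComplexField.Normc.normcM normc_real.
        apply: le_trans wv; case/andP: s01 => s0 s1.
        by rewrite ger0_norm // ler_piMl // normc_ge0.
      have -> : q - c = (q - v) + (v - (T n).1.1) + ((T n).1.1 - c) by ring.
      have := normcD (q - v + (v - (T n).1.1)) ((T n).1.1 - c).
      have := normcD (q - v) (v - (T n).1.1).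
      have := cT n; rewrite -/Pn; lra.
    have /rP : `|q - c| < r%:C%C.
      by rewrite norm_normc ltcR; apply: le_lt_trans qc _; lra.
    rewrite subrKC !norm_normc -rmorphM lecR opprD addrA => /le_trans -> //.
    rewrite -mulrA mulrCA ler_pM2l //.
  have := ler_wpM2l _ wv; move=> /(_ (2 * (6 * e * Pn))).
  rewrite !mulr_ge0 ?(ltW e0) // => /(_ isT) /le_trans -> //; lra.
have [Hx' Hy' Hz'] : [/\ H (T n).1.1, H (T n).1.2 & H (T n).2].
  by have [h1 h2 h3] := mT n; split; apply: lt_le_trans m0 _.
have sidesP := PT n; rewrite -/Pn /perimeter in sidesP.
have a1 := normc_ge0 ((T n).1.2 - (T n).1.1).
have a2 := normc_ge0 ((T n).2 - (T n).1.2).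
have a3 := normc_ge0 ((T n).1.1 - (T n).2).
have [s1 s2 s3] : [/\
    normc (I (T n).1.1 (T n).1.2 - (A (T n).1.2 - A (T n).1.1)) <= 12 * e * Pn * Pn,
    normc (I (T n).1.2 (T n).2 - (A (T n).2 - A (T n).1.2)) <= 12 * e * Pn * Pn &
    normc (I (T n).2 (T n).1.1 - (A (T n).1.1 - A (T n).2)) <= 12 * e * Pn * Pn].
  split; apply: side => //; rewrite ?subrr ?ComplexField.Normc.normc0 //; try lra.
  by rewrite normcB; lra.
have T3P : normc (triangle (T n)) <= 36 * e * Pn * Pn.
  have -> : triangle (T n) = (I (T n).1.1 (T n).1.2 - (A (T n).1.2 - A (T n).1.1)) +
    (I (T n).1.2 (T n).2 - (A (T n).2 - A (T n).1.2)) +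
    (I (T n).2 (T n).1.1 - (A (T n).1.1 - A (T n).2)) by rewrite /triangle; ring.
  have := normcD (I (T n).1.1 (T n).1.2 - (A (T n).1.2 - A (T n).1.1) +
    (I (T n).1.2 (T n).2 - (A (T n).2 - A (T n).1.2)))
    (I (T n).2 (T n).1.1 - (A (T n).1.1 - A (T n).2)).
  have := normcD (I (T n).1.1 (T n).1.2 - (A (T n).1.2 - A (T n).1.1))
    (I (T n).1.2 (T n).2 - (A (T n).2 - A (T n).1.2)).
  lra.
apply: le_trans (bigT n) _.
have -> : 36 * P ^+ 2 * e = 4 ^+ n * (36 * e * Pn * Pn).
  have h : 4 ^+ n * (2^-1 ^+ n * 2^-1 ^+ n) = 1 :> R.
    by rewrite -!exprMn (_ : 4 * (2^-1 * 2^-1) = 1 :> R) ?expr1n //; field.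
  transitivity (36 * P ^+ 2 * e * (4 ^+ n * (2^-1 ^+ n * 2^-1 ^+ n))).
    by rewrite h mulr1.
  by rewrite /Pn; move: (4 ^+ n) (2^-1 ^+ n) => a b; ring.
by rewrite ler_pM2l ?exprn_gt0.
Qed.

End Goursat.

(** * Primitives and Moebius substitutions *)

Section Primitive.
Variable R : realType.
Local Notation C := R[i].
Local Notation normc := (@ComplexField.Normc.normc R).
Local Notation H := (@upper_half_plane R).
Implicit Types (f F : C -> C) (g : 'M[R]_2).

Definition primitive f F := forall z, H z -> is_derive (z : C^o) 1 (F : C^o -> C^o) (f z).

Lemma complex_gt0 (e : C) : 0 < e -> exists2 r : R, 0 < r & e = r%:C%C.
Proof. by case: e => a b; rewrite ltcE /= => /andP[/eqP -> a0]; exists a. Qed.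

Lemma upper_half_plane_i : H 'i%C.
Proof. exact: ltr01. Qed.

(** By Goursat's theorem the increment of z |-> path_integral f 'i z between
    two points is the integral along the segment joining them, which the
    continuity of f compares with the increment of an affine function. *)
Lemma holomorphic_primitive f : holomorphic f -> exists F, primitive f F.
Proof.
move=> fH; have fc := holomorphic_continuous fH.
exists (path_integral f 'i%C) => z Hz; apply/is_derive_epsP => _ /complex_gt0[e e0 ->].
have /(@cvgrPdist_le _ _ _ (nbhs (z : C^o)) (nbhs_filter (z : C^o))) := fc z Hz.
move=> /(_ (e / 2)%:C%C); rewrite ltcR divr_gt0 // => /(_ isT)
  /nbhs_ballP[_ /= /complex_gt0[d d0 ->] dP].
exists (Num.min d (complex.Im z))%:C%C; first by rewrite ltcR lt_min d0.
move=> h; rewrite norm_normc ltcR lt_min => /andP[hd hz].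
have Hzh : H (z + h).
  have := Im_normc h; have := ler_norm (- complex.Im h); rewrite normrN.
  by rewrite /upper_half_plane /= raddfD /=; lra.
have tri := path_integral_triangle fH upper_half_plane_i Hz Hzh.
rewrite (path_integral_opp fH upper_half_plane_i Hzh) in tri.
have -> : path_integral f 'i%C (z + h) - path_integral f 'i%C z = path_integral f z (z + h).
  by move/eqP: tri; rewrite subr_eq0 => /eqP <-; rewrite addrC addKr.
rewrite !norm_normc -rmorphM lecR.
have := @path_integral_approx _ f fc (fun w => f z * w) (fun=> f z) z (z + h) (e / 2) Hz Hzh.
have zh : z + h - z = h by rewrite addrAC subrr add0r.
rewrite -mulrBr zh.
rewrite mulrCA divff ?pnatr_eq0 // mulr1; apply.
- move=> w _; apply/is_derive_epsP => r r0; exists 1 => // k _.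
  by rewrite -!mulrBr [w + k - w]addrAC subrr add0r subrr mulr0 normr0 mulr_ge0 // ltW.
- move=> t t01; rewrite normcB -lecR.
  apply: dP; rewrite /ball /= norm_normc ltcR; apply: le_lt_trans hd.
  rewrite normcB /segment addrC addKr zh.
  rewrite ComplexField.Normc.normcM normc_real; case/andP: t01 => t0 t1.
  by rewrite ger0_norm // ler_piMl // normc_ge0.
Qed.

Lemma path_integral_FTC f F x y :
  (forall z, H z -> {for z, continuous (f : C^o -> C^o)}) -> primitive f F ->
  H x -> H y -> path_integral f x y = F y - F x.
Proof.
move=> fc dF Hx Hy; apply/eqP; rewrite -subr_eq0; apply/eqP.
apply: ComplexField.Normc.eq0_normc; apply/eqP; rewrite eq_le normc_ge0 andbT.
have := @path_integral_approx _ f fc F f x y 0 Hx Hy dF; rewrite mulr0 mul0r; apply.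
by move=> t _; rewrite subrr ComplexField.Normc.normc0.
Qed.

Lemma is_derive_comp (K : numFieldType) (F G : K -> K) (x a b : K) :
  is_derive (G x : K^o) 1 (F : K^o -> K^o) a ->
  is_derive (x : K^o) 1 (G : K^o -> K^o) b ->
  is_derive (x : K^o) 1 (F \o G : K^o -> K^o) (a * b).
Proof.
move=> [dF aE] [dG bE].
have diffF : differentiable (F : K^o -> K^o) (G x) by apply/derivable1_diffP.
have diffG : differentiable (G : K^o -> K^o) x by apply/derivable1_diffP.
have diffFG := differentiable_comp diffG diffF.
have dFE := deriv1E dF; rewrite derive1E aE in dFE.
have dGE := deriv1E dG; rewrite derive1E bE in dGE.
apply: DeriveDef; first exact/derivable1_diffP.
apply: etrans (deriveE _ diffFG) _.
apply: etrans (congr1 (fun k : K^o -> K^o => k 1) (diff_comp diffG diffF)) _.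
apply: etrans (congr1 (fun k : K^o -> K^o => k _) dFE) _.
apply: etrans (congr1 (fun k : K^o -> K^o => k 1 *: (a : K^o)) dGE) _.
by rewrite scale1r; exact: mulrC.
Qed.

Lemma is_derive_affine (K : numFieldType) (u v x : K) :
  is_derive (x : K^o) 1 ((fun z => u * z + v) : K^o -> K^o) u.
Proof.
apply/is_derive_epsP => e e0; exists 1 => // h _.
suff -> : u * (x + h) + v - (u * x + v) - u * h = 0 by rewrite normr0 mulr_ge0 // ltW.
by ring.
Qed.

Lemma det_mx2 (K : comNzRingType) (g : 'M[K]_2) :
  \det g = g 0 0 * g 1 1 - g 0 1 * g 1 0.
Proof.
rewrite (expand_det_row _ 0) !big_ord_recl big_ord0 /cofactor !det_mx11 !mxE /=.
rewrite expr0 expr1 mul1r mulN1r mulrN addr0.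
by congr (g _ _ * g _ _ - g _ _ * g _ _); apply/val_inj.
Qed.

Lemma is_derive_moebius g (z : C) : cocycle g z != 0 ->
  is_derive (z : C^o) 1 (moebius g : C^o -> C^o) ((\det g)%:C%C * cocycle g z ^- 2).
Proof.
move=> cz.
have dn : is_derive (z : C^o) 1
    ((fun w => (g 0 0)%:C%C * w + (g 0 1)%:C%C) : C^o -> C^o) (g 0 0)%:C%C.
  exact: is_derive_affine.
have dc : is_derive (z : C^o) 1 (cocycle g : C^o -> C^o) (g 1 0)%:C%C.
  exact: is_derive_affine.
have di : is_derive (z : C^o) 1 ((fun w => (cocycle g w)^-1) : C^o -> C^o)
    (- cocycle g z ^- 2 * (g 1 0)%:C%C).
  have [dcz cE] := dc.
  by apply: DeriveDef; [exact: derivableV|rewrite deriveV // cE].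
apply: (is_derive_eq (is_deriveM dn di)).
rewrite det_mx2 rmorphB !rmorphM /=.
have sE (a b : C) : a *: (b : C^o) = a * b by [].
rewrite !sE; move: cz; rewrite /cocycle.
move: (g 0 0)%:C%C (g 0 1)%:C%C (g 1 0)%:C%C (g 1 1)%:C%C => a b c d cz.
by field; exact: cz.
Qed.

Lemma Im_moebius g z : complex.Im (moebius g z) =
  \det g * complex.Im z / normc (cocycle g z) ^+ 2.
Proof.
rewrite /moebius det_mx2; case: z => x y /=.
rewrite sqr_sqrtr ?addr_ge0 ?sqr_ge0 // !(mul0r, mulr0, subr0, addr0, add0r).
by ring.
Qed.

Lemma cocycle_neq0 g z : 0 < \det g -> H z -> cocycle g z != 0.
Proof.
rewrite det_mx2 /upper_half_plane => dg; case: z => x y /= y0; apply/eqP => -[].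
rewrite !mul0r subr0 !addr0 => h /eqP; rewrite mulf_eq0 (gt_eqF y0) orbF => /eqP c0.
by move: h dg; rewrite c0 mul0r add0r => ->; rewrite !mulr0 subrr ltxx.
Qed.

Lemma upper_half_plane_moebius g z : 0 < \det g -> H z -> H (moebius g z).
Proof.
move=> dg Hz; have n0 : 0 < normc (cocycle g z).
  rewrite lt_neqAle normc_ge0 andbT eq_sym; apply: contra_neq (cocycle_neq0 dg Hz).
  exact: ComplexField.Normc.eq0_normc.
by rewrite /upper_half_plane /= Im_moebius divr_gt0 ?mulr_gt0.
Qed.

Lemma moebiusM g h z : 0 < \det h -> H z ->
  moebius (g * h) z = moebius g (moebius h z).
Proof.
move=> dh Hz; have := cocycle_neq0 dh Hz; rewrite /moebius /cocycle.
rewrite !mxE !big_ord_recl !big_ord0 !addr0.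
have -> : lift ord0 ord0 = 1 :> 'I_2 by apply/val_inj.
rewrite !rmorphD !rmorphM /=.
have -> : (ord0 : 'I_2) = 0 by [].
move: (g 0 0)%:C%C (g 0 1)%:C%C (g 1 0)%:C%C (g 1 1)%:C%C => a b c d.
set k := (h 1 0)%:C%C * z + (h 1 1)%:C%C => k0.
have out (u v : C) : u * (((h 0 0)%:C%C * z + (h 0 1)%:C%C) / k) + v =
    (u * ((h 0 0)%:C%C * z + (h 0 1)%:C%C) + v * k) / k by field.
rewrite !out -mulf_div invrK mulVf // mulr1 /k; congr (_ / _); ring.
Qed.

Lemma primitive_moebius f F g : 0 < \det g -> primitive f F ->
  primitive (slash2 f g) (F \o moebius g).
Proof.
move=> dg dF z Hz; rewrite /slash2 mulrC; apply: is_derive_comp.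
  exact: dF (upper_half_plane_moebius dg Hz).
exact/is_derive_moebius/cocycle_neq0.
Qed.

(** Both sides are increments of primitives of ap * f: the functions
    F o gam_i add up to a primitive of hecke gam f. *)
Lemma path_integral_hecke (I : finType) (gam : I -> 'M[R]_2) f ap x y :
  holomorphic f -> (forall i, 0 < \det (gam i)) ->
  (forall z, H z -> hecke gam f z = ap * f z) -> H x -> H y ->
  \sum_i path_integral f (moebius (gam i) x) (moebius (gam i) y) =
  ap * path_integral f x y.
Proof.
move=> fH dgam feig Hx Hy; have [F dF] := holomorphic_primitive fH.
have fc := holomorphic_continuous fH.
have Hg i z : H z -> H (moebius (gam i) z) by apply: upper_half_plane_moebius.
rewrite (eq_bigr (fun i => F (moebius (gam i) y) - F (moebius (gam i) x))); last first.
  by move=> i _; apply: path_integral_FTC => //; exact: Hg.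
rewrite (path_integral_FTC fc dF) // mulrBr sumrB.
have afc z : H z -> {for z, continuous ((fun z => ap * f z) : C^o -> C^o)}.
  move=> Hz; apply: (@cvgM _ _ (nbhs (z : C^o)) _ (cst ap) f); first exact: cvg_cst.
  exact: fc.
have d1 : primitive (fun z => ap * f z) (fun z => ap * F z).
  by move=> z Hz; apply: is_deriveZ; exact: dF.
have d2 : primitive (fun z => ap * f z) (fun z => \sum_i F (moebius (gam i) z)).
  move=> z Hz; rewrite -feig // /hecke.
  have -> : (fun z => \sum_i F (moebius (gam i) z)) = \sum_i (F \o moebius (gam i)).
    by apply/funext => w; rewrite fct_sumE.
  have : forall i, is_derive (z : C^o) 1 (F \o moebius (gam i) : C^o -> C^o)
      (slash2 f (gam i) z).
    by move=> i; exact: (primitive_moebius (dgam i) dF Hz).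
  elim: (index_enum I) => [_|i s IH dh]; last first.
    by rewrite !big_cons; exact: (is_deriveD (dh i) (IH dh)).
  rewrite !big_nil; exact: is_derive_cst.
by rewrite -(path_integral_FTC afc d2 Hx Hy) (path_integral_FTC afc d1).
Qed.

End Primitive.

(** * Compact open sets of p-adic integers *)

Section Residues.
Variables (p : nat) (hp : prime p).
Local Notation Zp := (padic_int hp).
Implicit Types (x y : Zp) (U V : set Zp).

Lemma residue_add x y n : (x + y) n = ((x n + y n) %% (p ^ n)%N)%Z.
Proof. by []. Qed.

Lemma residue_mul x y n : (x * y) n = ((x n * y n) %% (p ^ n)%N)%Z.
Proof. by []. Qed.

Lemma residue_sub x y n : (x - y) n = ((x n - y n) %% (p ^ n)%N)%Z.
Proof. exact: modzDmr. Qed.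

Lemma residue1 n : (1 : Zp) n = (1 %% (p ^ n)%N)%Z.
Proof. by []. Qed.

Lemma residue_nat r n : (r%:R : Zp) n = (r%:Z %% (p ^ n)%N)%Z.
Proof.
elim: r => [|r IH]; first by [].
by rewrite -natr1 residue_add IH residue1 modzDm -PoszD addn1.
Qed.

Lemma expp_gt0 n : (0 < p ^ n)%N. Proof. by rewrite expn_gt0 prime_gt0. Qed.

Lemma residue_ge0 x n : 0 <= x n.
Proof. by rewrite -residue_mod modz_ge0 // eqz_nat -lt0n expp_gt0. Qed.

Lemma residue_lt x n : (`|x n| < p ^ n)%N.
Proof.
rewrite -ltz_nat gez0_abs ?residue_ge0 // -residue_mod ltz_pmod //.
by rewrite ltz_nat expp_gt0.
Qed.

Lemma residue_natK x n : (`|x n|%:R : Zp) n = x n.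
Proof. by rewrite residue_nat gez0_abs ?residue_ge0 // residue_mod. Qed.

Lemma residue_mono x y n m : (n <= m)%N -> x m = y m -> x n = y n.
Proof. by move=> nm xy; rewrite -(residue_le x nm) -(residue_le y nm) xy. Qed.

(** The quotient is computed at a precision n digits higher than the one
    wanted. *)
Lemma residue_eq0_dvd x n : x n = 0 -> exists y, x = p%:R ^+ n * y.
Proof.
move=> xn0; pose q m := (x (m + n)%N %/ (p ^ n)%N)%Z.
have qE m : q m * (p ^ n)%N = x (m + n)%N.
  rewrite /q divzK //; apply/dvdz_mod0P.
  by rewrite residue_le ?leq_addl.
have cq m : (q m.+1 = q m %[mod (p ^ m)%N])%Z.
  apply/eqP; rewrite eqz_mod_dvd -(@dvdz_mul2r (p ^ n)%N) ?gt_eqF ?ltz_nat ?expp_gt0 //.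
  rewrite mulrBl !qE -PoszM -expnD -eqz_mod_dvd addSn; apply/eqP.
  exact: mod_residueS.
exists (reduce hp cq); apply: padic_intP => m.
rewrite residue_mul -natrX residue_nat /= modzMml modzMmr mulrC qE.
by rewrite residue_le ?leq_addr.
Qed.

Lemma padic_cosetE x n y : padic_coset x n y <-> y n = x n.
Proof.
split=> [[z _ <-]|xy].
  rewrite residue_add residue_mul -natrX residue_nat modzz mul0r mod0z addr0.
  by rewrite residue_mod.
have [|z zE] := @residue_eq0_dvd (y - x) n.
  by rewrite residue_sub xy subrr mod0z.
by exists z => //; rewrite -zE addrC subrK.
Qed.

(** U is a union of cosets of p^n Z_p. *)
Definition saturated n U : Prop := forall x y, x n = y n -> U x -> U y.

Lemma saturated_le n m U : (n <= m)%N -> saturated n U -> saturated m U.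
Proof. by move=> nm sU x y /(residue_mono nm); exact: sU. Qed.

Lemma saturated_coset x n : saturated n (padic_coset x n).
Proof. by move=> y z yz /padic_cosetE yx; apply/padic_cosetE; rewrite -yz. Qed.

Lemma saturatedC n U : saturated n U -> saturated n (~` U).
Proof. by move=> sU x y xy nU /(sU y x); apply: contra_not nU => h; apply: h. Qed.

Lemma saturatedU n U V : saturated n U -> saturated n V -> saturated n (U `|` V).
Proof. by move=> sU sV x y xy [/sU|/sV] h; [left|right]; exact: h. Qed.

Lemma saturated_open n U : saturated n U -> open U.
Proof.
move=> sU; change (padic_open U) => x Ux; exists n => y /padic_cosetE yx.
by apply: sU Ux.
Qed.

Lemma saturated_closed n U : saturated n U -> closed U.
Proof. by move=> /saturatedC /saturated_open; rewrite openC. Qed.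

(** The points with a whole coset of level n inside U form an open set that
    grows with n and exhausts U. *)
Lemma compact_open_saturated U : is_compact_open U -> exists n, saturated n.+1 U.
Proof.
move=> [cU oU]; pose f n := [set x | padic_coset x n `<=` U].
have f_sat n : saturated n (f n).
  move=> x y xy fx z /padic_cosetE zy; apply: fx; apply/padic_cosetE.
  by rewrite xy.
have f_mono n m : (n <= m)%N -> f n `<=` f m.
  move=> nm x fx y /padic_cosetE yx; apply: fx; apply/padic_cosetE.
  exact: residue_mono yx.
have fU n : f n `<=` U by move=> x; apply; apply/padic_cosetE.
move: cU => /compact_near_coveringP /(_ nat \oo f _)[|N _ UfN].
  move=> x Ux; have [n xn] := oU x Ux.
  (* compactness in the form: what holds eventually near each point of U
     holds eventually on all of U *)
  exists (f n, [set m | (n <= m)%N]); last first.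
    by move=> [y m] /= [fy nm]; exact: f_mono fy.
  split; last exact: nbhs_infty_ge.
  by apply: open_nbhs_nbhs; split=> //; apply: saturated_open (f_sat n).
exists N; suff -> : U = f N by apply: saturated_le (f_sat _).
by apply/seteqP; split=> [x Ux|]; [apply: UfN Ux => /=|exact: fU].
Qed.

Lemma compact_open_sub n U V : is_compact_open U -> V `<=` U -> saturated n V ->
  is_compact_open V.
Proof.
move=> [cU _] VU sV; split; last exact: saturated_open sV.
by apply: subclosed_compact cU VU; exact: saturated_closed sV.
Qed.

(** The inverse is assembled from Bezout coefficients modulo each p^n, which
    are coherent because inverses modulo p^n are unique. *)
Lemma unit_residue x : x \is a GRing.unit <-> x 1%N != 0.
Proof.
split=> [xu|x1].
  apply/eqP => x10; have := congr1 (fun y : Zp => y 1%N) (mulVr xu).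
  rewrite residue_mul x10 mulr0 mod0z residue1 expn1 modz_small //.
  by rewrite ltz_nat prime_gt1.
have cop n : coprimez (x n) (p ^ n)%N.
  case: n => [|n]; first by rewrite coprimezE /= expn0 coprimen1.
  rewrite coprimezE /= coprimeXr // coprime_sym prime_coprime //.
  apply: contra x1 => h; rewrite -(@residue_le _ _ x 1 n.+1) // expn1.
  by apply/eqP/dvdz_mod0P; rewrite dvdzE.
pose u n := (egcdz (x n) (p ^ n)%N).1.
have ux n : (u n * x n = 1 %[mod (p ^ n)%N])%Z.
  rewrite /u; case: egcdzP => a b + _ /=; rewrite (eqP (cop n)) => <-.
  by rewrite [X in _ = (X %% _)%Z]addrC modzMDl.
have cu n : (u n.+1 = u n %[mod (p ^ n)%N])%Z.
  have ux' : (u n.+1 * x n = 1 %[mod (p ^ n)%N])%Z.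
    rewrite -modzMmr -(mod_residueS x n) modzMmr -(@modz_modulus p _ n n.+1) //.
    by rewrite ux modz_modulus.
  rewrite -[u n.+1]mulr1 -modzMmr -(ux n) modzMmr mulrCA -modzMmr ux' modzMmr.
  by rewrite mulr1.
apply/unitrP; exists (reduce hp cu).
have E : reduce hp cu * x = 1.
  by apply: padic_intP => n; rewrite residue_mul /= modzMml ux.
by split; last rewrite mulrC.
Qed.

(** * Distributions with compatible values on cosets *)

Section LevelSums.
Variables (M : zmodType) (w : nat -> nat -> M).
Hypothesis w_refine : forall n r, (r < p ^ n.+1)%N -> ~~ (p %| r)%N ->
  \sum_(b < p) w n.+2 (r + b * p ^ n.+1) = w n.+1 r.

Lemma sum_nat_mul (F : nat -> M) m k :
  \sum_(0 <= i < k * m) F i = \sum_(b < k) \sum_(0 <= r < m) F (r + b * m)%N.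
Proof.
elim: k => [|k IH]; first by rewrite mul0n big_geq // big_ord0.
rewrite big_ord_recr /= -IH (big_cat_nat (n := (k * m)%N)) ?leq_mul //=.
by congr (_ + _); rewrite -{1}[(k * m)%N]add0n mulSn big_addn addnK.
Qed.

(** The candidate for the measure of U, computed with the cosets of level n.
    Cosets inside p Z_p, those of the multiples of p, are left out. *)
Definition level_sum n U : M :=
  \sum_(0 <= r < p ^ n | `[< U r%:R >] && ~~ (p %| r)%N) w n r.

Lemma saturated_shift n U r b : saturated n U -> U (r + b * p ^ n)%N%:R <-> U r%:R.
Proof.
move=> sU; have E : ((r + b * p ^ n)%:R : Zp) n = (r%:R : Zp) n.
  by rewrite !residue_nat PoszD PoszM addrC modzMDl.
by split; apply: sU.
Qed.

Lemma dvdn_shift n r b : (p %| r + b * p ^ n.+1)%N = (p %| r)%N.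
Proof. by rewrite dvdn_addl // expnS mulnCA dvdn_mulr. Qed.

Lemma level_sumS n U : saturated n.+1 U -> level_sum n.+2 U = level_sum n.+1 U.
Proof.
move=> sU; rewrite /level_sum big_mkcond expnS sum_nat_mul exchange_big /=.
rewrite [RHS]big_mkcond !big_nat; apply: eq_bigr => r /= rp.
under eq_bigr => b _ do rewrite dvdn_shift (asbool_equiv_eq (saturated_shift r b sU)).
by case: ifP => [/andP[_ /w_refine <-]|_] //; rewrite big1_eq.
Qed.

Lemma level_sum_eq n m U : saturated n.+1 U -> saturated m.+1 U ->
  level_sum n.+1 U = level_sum m.+1 U.
Proof.
wlog nm : n m / (n <= m)%N.
  by move=> IH sn sm; case/orP: (leq_total n m) => nm; [|symmetry]; exact: IH.
move=> sn _; elim: m nm => [|m IH]; first by rewrite leqn0 => /eqP ->.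
rewrite leq_eqVlt => /predU1P[-> //|]; rewrite ltnS => nm.
by rewrite level_sumS ?IH //; apply: saturated_le sn.
Qed.

(** [level_sum] at any level for which U is saturated; zero is a default value
    for the sets that are saturated at no level. *)
Definition limit_measure U : M :=
  if pselect (exists n, saturated n.+1 U) is left ex then level_sum (projT1 (cid ex)).+1 U
  else 0.

Lemma limit_measureE n U : saturated n.+1 U -> limit_measure U = level_sum n.+1 U.
Proof.
move=> sU; rewrite /limit_measure; case: pselect => [ex|]; last by case; exists n.
by apply: level_sum_eq => //; exact: projT2 (cid ex).
Qed.

Lemma limit_measure_distribution : is_distribution limit_measure.
Proof.
move=> U V /compact_open_saturated[n sU] /compact_open_saturated[m sV] UV0.
have {}sU : saturated (maxn n m).+1 U by apply: saturated_le sU; rewrite ltnS leq_maxl.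
have {}sV : saturated (maxn n m).+1 V by apply: saturated_le sV; rewrite ltnS leq_maxr.
rewrite !(limit_measureE (n := maxn n m)) //; last exact: saturatedU.
rewrite /level_sum big_mkcond [X in _ = X + _]big_mkcond [X in _ = _ + X]big_mkcond.
rewrite -big_split; apply: eq_bigr => r _ /=.
have -> : `[< (U `|` V) r%:R >] = `[< U r%:R >] || `[< V r%:R >].
  by apply/asboolP/orP => -[] h; [left|right|left|right]; apply/asboolP.
case: (p %| r)%N; rewrite ?andbF ?addr0 // !andbT.
case: asboolP => Ur; case: asboolP => Vr /=; rewrite ?addr0 ?add0r //.
by have : (U `&` V) r%:R by []; rewrite UV0.
Qed.

Lemma limit_measure_coset n r : (r < p ^ n.+1)%N -> ~~ (p %| r)%N ->
  limit_measure (padic_coset r%:R n.+1) = w n.+1 r.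
Proof.
move=> rp pr; rewrite (limit_measureE (n := n)); last exact: saturated_coset.
rewrite /level_sum big_mkord (bigD1 (Ordinal rp)) /=; last first.
  by rewrite pr andbT; apply/asboolP/padic_cosetE.
rewrite big1 ?addr0 // => i /andP[/andP[/asboolP/padic_cosetE + _]].
rewrite !residue_nat !modz_small ?ltz_nat ?ltn_ord // => -[ir].
by case/eqP; apply: val_inj.
Qed.

Lemma in_multiples x : padic_coset 0 1 x <-> x 1%N = 0.
Proof.
split=> [/padic_cosetE ->|x0]; first exact: mod0z.
by apply/padic_cosetE; rewrite x0; apply/esym/mod0z.
Qed.

Lemma nat_in_multiples r : padic_coset 0 1 (r%:R : Zp) <-> (p %| r)%N.
Proof.
split=> [/in_multiples|pr]; [|apply/in_multiples]; rewrite residue_nat expn1.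
  by move/dvdz_mod0P; rewrite dvdzE.
by apply/dvdz_mod0P; rewrite dvdzE.
Qed.

Lemma limit_measure_multiples n U : saturated n.+1 U -> U `<=` padic_coset 0 1 ->
  limit_measure U = 0.
Proof.
move=> sU Up; rewrite (limit_measureE sU) /level_sum big1 // => r /andP[/asboolP/Up].
by move/nat_in_multiples ->.
Qed.

Lemma limit_measure_units : limit_measure [set x | x \is a GRing.unit] =
  \sum_(1 <= a < p) limit_measure (padic_coset a%:R 1).
Proof.
have su : saturated 1 [set x : Zp | x \is a GRing.unit].
  by move=> x y xy /= /unit_residue; rewrite xy => /unit_residue.
rewrite (limit_measureE su) /level_sum expn1 big_ltn_cond ?prime_gt0 //.
case: ifP => [/andP[_]|_]; first by rewrite (dvdn0 p).
rewrite big_nat_cond [RHS]big_nat_cond; apply: eq_big => [a|a].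
  rewrite andbT andb_idr // => /andP[a1 ap].
  have pa : ~~ (p %| a)%N by rewrite gtnNdvd.
  rewrite pa andbT; apply/asboolP/unit_residue.
  by apply: contra pa => /eqP/in_multiples/nat_in_multiples.
move=> /andP[/andP[a1 ap] _]; rewrite limit_measure_coset ?expn1 //.
by rewrite gtnNdvd.
Qed.

(** The points of U with residue less than k modulo p^(n+1) form an increasing
    family of compact open sets; each step adds at most one coset. *)
Lemma distribution_level_sum (mu : set Zp -> M) : is_distribution mu ->
  (forall n r, (r < p ^ n.+1)%N -> ~~ (p %| r)%N -> mu (padic_coset r%:R n.+1) = w n.+1 r) ->
  (forall U, is_compact_open U -> U `<=` padic_coset 0 1 -> mu U = 0) ->
  forall U, is_compact_open U -> mu U = limit_measure U.
Proof.
move=> mu_add mu_coset mu_mult U cU; have [n sU] := compact_open_saturated cU.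
rewrite (limit_measureE sU).
pose V k := U `&` [set x | (`|x n.+1| < k)%N].
have sV k : saturated n.+1 (V k).
  by move=> x y xy [Ux xk]; split; [exact: sU Ux|rewrite /= -xy].
have cV k : is_compact_open (V k) by apply: compact_open_sub cU _ (sV k); exact: subIsetl.
have cC r : U r%:R -> is_compact_open (padic_coset (r%:R : Zp) n.+1).
  move=> Ur; apply: compact_open_sub cU _ (@saturated_coset r%:R n.+1).
  by move=> x /padic_cosetE xr; apply: sU Ur.
have c0 : is_compact_open (@set0 Zp).
  by apply: (@compact_open_sub 0 U set0) => // x y _.
have mu0 : mu set0 = 0.
  by apply: (addrI (mu set0)); rewrite -mu_add ?setI0 // setU0 addr0.
suff VE k : (k <= p ^ n.+1)%N ->
    mu (V k) = \sum_(0 <= r < k | `[< U r%:R >] && ~~ (p %| r)%N) w n.+1 r.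
  rewrite /level_sum -VE //; congr mu; apply/seteqP; split=> [x Ux|x []//].
  by split => //=; exact: residue_lt.
elim: k => [_|k IH kp].
  rewrite big_geq // -mu0; congr mu; apply/seteqP; split=> // x [_].
  by rewrite /= ltn0.
have kE : (k%:R : Zp) n.+1 = k by rewrite residue_nat modz_small.
have VS : V k.+1 = V k `|` (U `&` padic_coset k%:R n.+1).
  apply/seteqP; split=> x.
    move=> [Ux /=]; rewrite ltnS leq_eqVlt => /predU1P[xk|xk]; last by left.
    right; split=> //; apply/padic_cosetE; rewrite kE -xk gez0_abs //.
    exact: residue_ge0.
  move=> [[Ux xk]|[Ux /padic_cosetE xk]]; split=> //=; first exact: ltnW.
  by rewrite xk kE.
have Vdisj : V k `&` (U `&` padic_coset k%:R n.+1) = set0.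
  rewrite -subset0 => x [[_ xk] [_ /padic_cosetE xk']].
  by move: xk; rewrite /= xk' kE /= ltnn.
rewrite big_mkcond big_nat_recr //= -big_mkcond -IH; last exact: ltnW.
have [Uk|nUk] := pselect (U k%:R); last first.
  have -> : V k.+1 = V k.
    rewrite VS [X in _ `|` X](_ : _ = set0) ?setU0 // -subset0 => x [Ux /padic_cosetE xk].
    by apply: nUk; apply: sU Ux.
  by case: asboolP => //; rewrite addr0.
have UI : U `&` padic_coset k%:R n.+1 = padic_coset k%:R n.+1.
  by apply/setIidPr => x /padic_cosetE xk; apply: sU Uk.
rewrite VS UI in Vdisj *; rewrite mu_add //; last exact: cC.
congr (_ + _); case: asboolP => //= _; case: ifPn => [pk|]; first exact: mu_coset.
rewrite negbK => pk; apply: mu_mult; first exact: cC.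
move=> x /padic_cosetE xk; apply/in_multiples.
rewrite (residue_mono _ xk) //; apply/in_multiples; exact/nat_in_multiples.
Qed.

End LevelSums.

End Residues.

(** * Coordinates and spans *)

Section Coordinates.
Variables (F : fieldType) (x : F).
Local Notation K := (adjoin_field x).
Variables (I : set nat) (e : nat -> F).

Lemma coordinates0 : coordinates I e 0 (0 : c00 K).
Proof. by split=> //; rewrite fsbig1 // => i _; rewrite mul0r. Qed.

(** The sums over the possibly infinite set I are first brought to a common
    finite index set. *)
Lemma coordinatesD u v (c d : c00 K) :
  coordinates I e u c -> coordinates I e v d -> coordinates I e (u + v) (c + d).
Proof.
move=> [cI ->] [dI ->]; split=> [i nIi|].
  by apply: etrans (addr0 (0 : K)); congr (_ + _); [exact: cI|exact: dI].
pose S := [set i | c i != 0] `|` [set i | d i != 0].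
have finS : finite_set (S `&` I).
  apply: finite_setIl; rewrite finite_setU.
  by split; [case: c {cI S} => ? /= /asboolP|case: d {dI S} => ? /= /asboolP].
have widen (b : c00 K) : (forall i, ~ S i -> b i = 0) ->
    \sum_(i \in I) (b i : F) * e i = \sum_(i <- fset_set (S `&` I)) (b i : F) * e i.
  move=> bS; rewrite -fsbig_finite //; apply/esym/fsbig_widen => [i []//|i [Ii nSi]].
  rewrite /= bS ?mul0r // => Si; exact: nSi.
have cS i : ~ S i -> c i = 0 by move/not_orP => [/negP]; rewrite negbK => /eqP.
have dS i : ~ S i -> d i = 0 by move/not_orP => [_ /negP]; rewrite negbK => /eqP.
rewrite !widen //; last first.
  move=> i nSi; apply: etrans (addr0 (0 : K)).
  by congr (_ + _); [exact: cS|exact: dS].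
rewrite -big_split; apply: eq_bigr => i _ /=; by rewrite -mulrDl.
Qed.

Variables (W : set F) (L : fieldType) (h : {rmorphism K -> L}).
Hypothesis (We : is_basis x W I e).
Local Notation val := (to_c00 h I e).

(** On W the choice made by to_c00 is forced by uniqueness of coordinates. *)
Lemma to_c00E w c : W w -> coordinates I e w c -> val w = c00_map h c.
Proof.
move=> Ww wc; rewrite /to_c00; congr (c00_map h _).
have [c' [_ uniq_c]] := We.2 w Ww; rewrite -(uniq_c c wc); apply/esym.
case: xgetP => [d _ wd|/(_ c)//]; exact: uniq_c.
Qed.

Lemma to_c00D u v : W u -> W v -> W (u + v) -> val (u + v) = val u + val v.
Proof.
move=> Wu Wv Wuv; have [c [uc _]] := We.2 u Wu; have [d [vd _]] := We.2 v Wv.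
rewrite (to_c00E Wu uc) (to_c00E Wv vd) (to_c00E Wuv (coordinatesD uc vd)).
by apply: val_inj; apply/funext => i; exact: rmorphD.
Qed.

Lemma to_c00_sum (J : finType) (u : J -> F) : W 0 ->
  (forall a b, W a -> W b -> W (a + b)) -> (forall j, W (u j)) ->
  val (\sum_j u j) = \sum_j val (u j).
Proof.
move=> W0 WD Wu; suff [] : W (\sum_j u j) /\ val (\sum_j u j) = \sum_j val (u j) by [].
apply: (big_rec2 (fun a b => W a /\ val a = b)).
  split=> //; rewrite (to_c00E W0 coordinates0).
  by apply: val_inj; apply/funext => i; exact: rmorph0.
by move=> j a b _ [Wb <-]; split; [exact: WD|rewrite to_c00D //; exact: WD].
Qed.

End Coordinates.

Section Subspaces.
Variables (F : fieldType).
Implicit Types (K S : set F).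

Lemma linear_span_subspace K S : is_subspace K (linear_span K S).
Proof.
split=> [V [[V0 _] _] //|c u v Kc Su Sv V VP].
by have [[_ VZD] _] := VP; apply: VZD => //; [exact: Su|exact: Sv].
Qed.

Lemma adjoinX (x : F) n : adjoin x (x ^- n).
Proof.
have xx : x \in in_adjoin x by apply/asboolP => K [_]; exact.
by have /asboolP : x ^- n \in in_adjoin x by rewrite rpredV rpredX.
Qed.

Lemma adjoinN1 (x : F) : adjoin x (-1).
Proof. by have /asboolP : -1 \in in_adjoin x by rewrite rpredN rpred1. Qed.

Lemma adjoin1 (x : F) : adjoin x 1.
Proof. by have /asboolP : 1 \in in_adjoin x by rewrite rpred1. Qed.

End Subspaces.

(** * Digits in base p *)

Section Digits.
Variables (p : nat) (p_gt0 : (0 < p)%N).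

Definition digit r i := (r %/ p ^ i %% p)%N.

Lemma digit_expansion r n : (\sum_(i < n) digit r i * p ^ i = r %% p ^ n)%N.
Proof.
elim: n => [|n IH]; first by rewrite big_ord0 modn1.
rewrite big_ord_recr /= IH /digit modn_divl -expnS.
by rewrite [RHS](divn_eq _ (p ^ n)) modn_dvdm ?dvdn_exp2l // addnC.
Qed.

Lemma digit_low r c n i : (i < n)%N -> digit (r + c * p ^ n) i = digit r i.
Proof.
move=> lt_in; rewrite /digit.
have -> : (c * p ^ n = c * p ^ (n - i.+1) * p * p ^ i)%N.
  by rewrite -!mulnA -expnS -expnD subnK.
by rewrite divnDMl ?expn_gt0 ?p_gt0 // addnC modnMDl.
Qed.

Lemma digit_top r c n : (r < p ^ n)%N -> (c < p)%N -> digit (r + c * p ^ n) n = c.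
Proof.
by move=> rn cp; rewrite /digit divnDMl ?expn_gt0 ?p_gt0 // divn_small // modn_small.
Qed.

Lemma expansion_lt n (d : 'I_n -> 'I_p) : (\sum_(i < n) d i * p ^ i < p ^ n)%N.
Proof.
elim: n d => [|n IH] d; first by rewrite big_ord0.
rewrite big_ord_recr /= expnS.
apply: leq_trans (_ : (d ord_max).+1 * p ^ n <= _)%N; last by rewrite leq_mul.
by rewrite mulSn ltn_add2r (IH (fun i => d (widen_ord (leqnSn n) i))).
Qed.

Lemma expansion_digit n (d : 'I_n -> 'I_p) (i : 'I_n) :
  digit (\sum_(i < n) d i * p ^ i)%N i = d i.
Proof.
elim: n d i => [|n IH] d i; first by case: i.
rewrite big_ord_recr /=.
have [in_|ni] := ltnP i n; last first.
  have -> : i = ord_max by apply: val_inj; apply/eqP; rewrite eqn_leq ni -ltnS ltn_ord.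
  by rewrite digit_top // (expansion_lt (fun i => d (widen_ord (leqnSn n) i))).
rewrite digit_low // (IH (fun i => d (widen_ord (leqnSn n) i)) (Ordinal in_)).
by congr (val (d _)); exact: val_inj.
Qed.

Definition digits n r (i : 'I_n) : 'I_p := Ordinal (ltn_pmod (r %/ p ^ i) p_gt0).

Arguments digits : clear implicits.

Lemma digits_expansion n (d : 'I_n -> 'I_p) : digits n (\sum_(i < n) d i * p ^ i)%N = d.
Proof. by apply/funext => i; apply: val_inj; exact: expansion_digit. Qed.

Lemma opp_digitK : involutive (@opp_digit p).
Proof.
move=> i; apply: val_inj => /=; have := ltn_ord i; case: (posnP i) => [-> _|i0 ip].
  by rewrite subn0 modnn subn0 modnn.
have pi : (p - i < p)%N by rewrite ltn_subrL i0.
by rewrite (modn_small pi) subKn ?modn_small // ltnW.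
Qed.

End Digits.

Arguments digits {p} p_gt0 n r i.

(** * Values of words in the coset representatives *)

Section Words.
Variables (R : realType) (p : nat).
Local Notation C := R[i].
Local Notation H := (@upper_half_plane R).
Variables (gam : 'I_p -> 'M[R]_2) (f : C -> C) (ap tau : C).
Hypotheses (fH : holomorphic f) (dgam : forall j, 0 < \det (gam j)).
Hypothesis (feig : forall z, H z -> hecke gam f z = ap * f z).
Hypotheses (ap0 : ap != 0) (Htau : H tau).

Lemma word_det n (d : 'I_n -> 'I_p) : 0 < \det (word gam d).
Proof.
rewrite /word; elim: (index_enum _) => [|i s IH]; first by rewrite big_nil det1.
by rewrite big_cons det_mulmx mulr_gt0.
Qed.

Lemma wordS n (d : 'I_n.+1 -> 'I_p) :
  word gam d = gam (d ord_max) * word gam (fun i => d (widen_ord (leqnSn n) i)).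
Proof.
rewrite /word big_ord_recl; congr (gam (d _) * _).
  by apply: val_inj; rewrite /= subn1.
apply: eq_bigr => i _; congr (gam (d _)); apply: val_inj => /=.
by rewrite /bump /= add1n subSS.
Qed.

Lemma moebius_word n (d : 'I_n -> 'I_p) : H (moebius (word gam d) tau).
Proof. by apply: upper_half_plane_moebius; [exact: word_det|]. Qed.

Lemma word_valueS n (d : 'I_n.+1 -> 'I_p) :
  word_value gam f tau d = path_integral f (moebius (gam (d ord_max))
    (moebius (word gam (fun i => d (widen_ord (leqnSn n) i))) tau)) tau.
Proof. by rewrite /word_value wordS moebiusM //; exact: word_det. Qed.

(** The last sum is the constant, independent of x, that cancels in the
    difference of two words. *)
Lemma sum_path_integral x : H x ->
  \sum_j path_integral f (moebius (gam j) x) tau =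
  ap * path_integral f x tau + \sum_j path_integral f (moebius (gam j) tau) tau.
Proof.
move=> Hx; rewrite -(path_integral_hecke fH dgam feig Hx Htau) -big_split.
apply: eq_bigr => j _ /=.
have [Hgx Hgt] : H (moebius (gam j) x) /\ H (moebius (gam j) tau).
  by split; apply: upper_half_plane_moebius.
have := path_integral_triangle fH Hgx Hgt Htau.
by rewrite (path_integral_opp fH Hgx Htau) => /eqP; rewrite subr_eq0 => /eqP.
Qed.

(** The words ext b prolong d by one letter on the left, the letter running
    over all indices as b does. *)
Lemma sum_word_value n (d : 'I_n -> 'I_p) (ext : 'I_p -> 'I_n.+1 -> 'I_p) (s : 'I_p -> 'I_p) :
  injective s -> (forall b, ext b ord_max = s b) ->
  (forall b i, ext b (widen_ord (leqnSn n) i) = d i) ->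
  \sum_b word_value gam f tau (ext b) =
  ap * word_value gam f tau d + \sum_j path_integral f (moebius (gam j) tau) tau.
Proof.
move=> s_inj ext_max ext_widen; rewrite -(sum_path_integral (moebius_word d)).
rewrite [RHS](reindex_inj s_inj); apply: eq_bigr => b _.
have extE : (fun i => ext b (widen_ord (leqnSn n) i)) = d.
  by apply/funext => i; rewrite ext_widen.
by rewrite word_valueS ext_max extE.
Qed.

(** The refinement relation for the values on cosets. *)
Lemma sum_mu_value (p0 : (0 < p)%N) (sigma : {perm 'I_p}) n r : (r < p ^ n)%N ->
  \sum_(b < p) mu_value gam sigma f tau ap (digits p0 n.+1 (r + b * p ^ n)%N) =
  mu_value gam sigma f tau ap (digits p0 n r).
Proof.
move=> rn; rewrite /mu_value -mulr_sumr sumrB.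
have top (b : 'I_p) : digits p0 n.+1 (r + b * p ^ n)%N ord_max = b.
  by apply: val_inj; exact: (digit_top p0 rn).
have low (b : 'I_p) i : digits p0 n.+1 (r + b * p ^ n)%N (widen_ord (leqnSn n) i) =
    digits p0 n r i.
  by apply: val_inj; exact: (digit_low p0 r b (ltn_ord i)).
have inj_opp : injective (sigma \o @opp_digit p).
  by apply: inj_comp; [exact: perm_inj|exact: inv_inj (opp_digitK p0)].
pose dr := digits p0 n r.
pose db (b : 'I_p) := digits p0 n.+1 (r + b * p ^ n)%N.
have S1 : \sum_b word_value gam f tau (fun i => sigma (db b i)) =
    ap * word_value gam f tau (fun i => sigma (dr i)) +
    \sum_j path_integral f (moebius (gam j) tau) tau.
  by apply: (sum_word_value (@perm_inj _ sigma)) => [b|b i]; rewrite /db ?top ?low.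
have S2 : \sum_b word_value gam f tau (fun i => sigma (opp_digit (db b i))) =
    ap * word_value gam f tau (fun i => sigma (opp_digit (dr i))) +
    \sum_j path_integral f (moebius (gam j) tau) tau.
  by apply: (sum_word_value inj_opp) => [b|b i]; rewrite /db ?top ?low.
rewrite S1 S2 opprD addrACA subrr addr0 -mulrBr mulrA; congr (_ * _).
by rewrite exprSr invfM mulfVK.
Qed.

Lemma mu_value_in sigma n (d : 'I_n -> 'I_p) :
  value_space gam f tau ap (mu_value gam sigma f tau ap d).
Proof.
have [W0 WP] := linear_span_subspace (adjoin ap)
  [set w | exists n, exists d : 'I_n -> 'I_p, w = word_value gam f tau d].
have ww m (d' : 'I_m -> 'I_p) : value_space gam f tau ap (word_value gam f tau d').
  by apply: sub_gen_smallest; exists m, d'.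
rewrite /mu_value; set u := word_value _ _ _ _; set v := word_value _ _ _ _.
have Wuv : value_space gam f tau ap (-1 * v + u).
  by apply: WP; [exact: adjoinN1|exact: ww|exact: ww].
have -> : ap ^- n * (u - v) = ap ^- n * (-1 * v + u) + 0 by ring.
by apply: WP => //; exact: adjoinX.
Qed.

End Words.

(** * Determinants of the coset representatives *)

Section Embedding.
Variable R : realType.

Lemma quat_embed1 (a b : rat) : quat_embed R (1 : quat a b) = 1.
Proof.
apply/matrixP => i j; rewrite !mxE rmorph0 rmorph1.
by case: i => [[|[|//]] hi]; case: j => [[|[|//]] hj] /=;
  rewrite ?mul0r ?addr0 ?subr0 ?subrr ?mulr0.
Qed.

Lemma det_quat_embed (a b : rat) (w : quat a b) : 0 <= a ->
  \det (quat_embed R w) = ratr (nrd w).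
Proof.
move=> a0; rewrite det_mx2; case: w => x y z t; rewrite !mxE /= /nrd /=.
have /(@sqr_sqrtr R) s2 : 0 <= ratr a :> R by rewrite ler0q.
rewrite !expr2 !rmorphD !rmorphN !rmorphM /= -[in RHS]s2.
by move: (Num.sqrt _) (ratr x) (ratr y) (ratr z) (ratr t) (ratr b) => s x' y' z' t' b'; ring.
Qed.

End Embedding.

Lemma eichler_order1 (a b : rat) (O : set (quat a b)) N : is_eichler_order O N -> O 1.
Proof. by move=> [A [B [[[A1 _ _ _ _] _] [[B1 _ _ _ _] _] -> _]]]; split. Qed.

(** Each representative lies in the double coset, as the identity is in the
    group, so its determinant is the reduced norm of omega. *)
Lemma det_coset_representative (R : realType) (a b : rat) (O : set (quat a b))
    (omega : quat a b) (J : finType) (gam : J -> 'M[R]_2) :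
  0 <= a -> O 1 -> 0 < nrd omega ->
  coset_representatives (Gamma R O) (quat_embed R omega) gam ->
  forall j, 0 < \det (gam j).
Proof.
move=> a0 O1 om0 [cosE _] j.
have det1 g : Gamma R O g -> \det g = 1.
  by move=> [w [_ w1] <-]; rewrite det_quat_embed // w1 rmorph1.
have G1 : Gamma R O 1.
  by exists 1; [split=> //=; rewrite /nrd /=; ring|rewrite quat_embed1].
have : double_coset (Gamma R O) (quat_embed R omega) (gam j).
  by rewrite cosE; exists j => //; exists 1 => //; exact: mul1mx.
case=> g [h [Gg Gh ->]]; rewrite !det_mulmx (det1 g) // (det1 h) // mul1r mulr1.
by rewrite det_quat_embed // ltr0q.
Qed.

Theorem proposition4p15 (R : realType)
  (* the quaternion algebra (a, b / Q), of discriminant D, with an Eichler order of level N *)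
  (a b : rat) (a_gt0 : 0 < a) (b_neq0 : b != 0)
  (D : nat) (D_gt1 : (1 < D)%N) (HD : is_discriminant a b D)
  (O : set (quat a b)) (N : nat) (HO : is_eichler_order O N)
  (p : nat) (hp : prime p) (pN : (p %| N)%N) (pD : ~~ (p %| D)%N)
  (* T_p and its eigenform f *)
  (omega : quat a b) (Homega : nrd omega = p%:R)
  (gam : 'I_p -> 'M[R]_2)
  (Hgam : coset_representatives (Gamma R O) (quat_embed R omega) gam)
  (f : R[i] -> R[i]) (Hf : S2 (Gamma R O) f)
  (ap : R[i]) (f_eigen : eigenform gam f ap) (ap_neq0 : ap != 0)
  (tau : R[i]) (Htau : quadratic_imaginary tau)
  (sigma : {perm 'I_p})
  (sigma0 : forall i : 'I_p, i = 0%N :> nat -> sigma i = 0%N :> nat)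
  (* the field C_p, an embedding of Q(a_p), and a basis of the span of the values *)
  (Cp : padicComplexType R hp) (iota : {rmorphism adjoin_field ap -> Cp})
  (I : set nat) (e : nat -> R[i])
  (He : is_basis ap (value_space gam f tau ap) I e) :
  let extension := extends_mu (hp := hp) gam sigma f tau ap (to_c00 iota I e) in
  exists mu : set (padic_int hp) -> c00 Cp,
    extension mu /\
    forall mu', extension mu' -> forall U, is_compact_open U -> mu' U = mu U.
Proof.
move=> extension; have p0 := prime_gt0 hp.
have dgam : forall j, 0 < \det (gam j).
  apply: det_coset_representative Hgam; rewrite ?Homega ?ltr0n // ?(ltW a_gt0) //.
  exact: eichler_order1 HO.
have [fH _] := Hf; have [_ feig] := f_eigen; have [Ht _] := Htau.
pose W := value_space gam f tau ap; pose val := to_c00 iota I e.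
have [W0 WP] : is_subspace (adjoin ap) W by exact: linear_span_subspace.
have WD u v : W u -> W v -> W (u + v).
  by move=> Wu Wv; rewrite -[u]mul1r; apply: WP => //; exact: adjoin1.
pose w n r := val (mu_value gam sigma f tau ap (digits p0 n r)).
have w_refine n r : (r < p ^ n.+1)%N -> ~~ (p %| r)%N ->
    \sum_(b < p) w n.+2 (r + b * p ^ n.+1)%N = w n.+1 r.
  move=> rn _; rewrite /w -(sum_mu_value fH dgam feig ap_neq0 Ht p0 sigma rn).
  rewrite /val (to_c00_sum iota He W0 WD) // => b'; exact: mu_value_in.
have digit0 r : digit p r 0 = (r %% p)%N by rewrite /digit expn0 divn1.
exists (limit_measure (hp := hp) w); split.
  split.
  - exact: (@limit_measure_distribution _ hp _ w w_refine).
  - move=> n d d0.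
    rewrite (@limit_measure_coset _ hp _ w w_refine); first by rewrite /w digits_expansion.
      exact: expansion_lt.
    by rewrite /dvdn -digit0 (expansion_digit p0 d ord0).
  - exact: (@limit_measure_units _ hp _ w w_refine).
  - apply: (@limit_measure_multiples _ hp _ w w_refine 0) => //.
    exact: saturated_coset.
  - move=> U /compact_open_saturated[n sU]; exact: (@limit_measure_multiples _ hp _ w w_refine n).
move=> mu' [mu'D mu'E _ _ mu'0]; apply: (@distribution_level_sum _ hp _ w w_refine) => // n r rn pr.
have rE := digit_expansion p r n.+1; rewrite modn_small // in rE.
rewrite -[in LHS]rE (mu'E n (digits p0 n.+1 r)) //.
by rewrite /= expn0 divn1.
Qed.
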